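(* For a connected graph $G$ the following conditions are equivalent: (i) $G$ is a partial double tree; (ii) $G$ is a median subgraph of the Cartesian product of two trees; (iii) $G$ is a median graph such that $\mathrm{Inc}(G)$ is bipartite; (iv) $G$ is a median graph such that $\mathrm{Link}(|G|)$ is bipartite; (v) $G$ is a median graph such that $\mathrm{Link}(x)$ is bipartite for all vertices $x$ of $G$; (vi) $G$ is a median graph that does not contain $Q_3-v$ nor any $\kappa(C_{2k+1})$ $(k\ge 2)$ as an isometric subgraph; (vii) $G$ is an isometric subgraph of a hypercube such that $C_{2k+2}$ and $\kappa(C_{2k+1})$ $(k\ge 2)$ are not isometric subgraphs of $G$; (viii) $C_3$, $K_{2,3}$, $C_{k+3}$, and $\kappa(C_{2k+1})$ $(k\ge 2)$ are not isometric subgraphs of $G$.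
   Context: Graphs are simple, undirected and possibly infinite; a connected graph $G=(V,E)$ carries the shortest-path metric $d_G$. Subgraph relations are understood up to isomorphism. An induced subgraph of $G$ is an isometric subgraph if the distances between its vertices, computed inside it, coincide with those in $G$. The interval is $I(x,y)=\{z: d(x,y)=d(x,z)+d(z,y)\}$. $G$ is a median graph if $I(x,y)\cap I(y,z)\cap I(z,x)$ is a single vertex (the median of $x,y,z$) for all vertices $x,y,z$. A median subgraph of a median graph $H$ is an isometric subgraph of $H$ whose vertex set is closed under taking medians in $H$. A partial double tree is a graph that is isometrically embeddable into the Cartesian product of two trees (trees may be infinite). A hypercube is a (weak) Cartesian power of $K_2$ (vertices are the finite subsets of some set, adjacent when they differ in exactly one element); $Q_3$ is the 3-dimensional cube and $Q_3-v$ is $Q_3$ with one vertex removed. $C_n$ is the cycle with $n$ vertices. The simplex graph $\kappa(F)$ of a graph $F$ has as vertices the cliques of $F$ (including the empty clique), two cliques being adjacent when they differ by the presence or absence of exactly one vertex of $F$. A set of vertices $Y$ is convex if $I(x,y)\subseteq Y$ for all $x,y\in Y$. A convex split of $G$ is a partition $\{A,B\}$ of $V$ into two nonempty convex sets. Two convex splits $\{A_1,B_1\}$, $\{A_2,B_2\}$ are incompatible if all four intersections $A_1\cap A_2$, $A_1\cap B_2$, $B_1\cap A_2$, $B_1\cap B_2$ are nonempty. The incompatibility graph $\mathrm{Inc}(G)$ has the convex splits of $G$ as vertices and the pairs of incompatible convex splits as edges. $|G|$ is the cubical complex obtained from $G$ by replacing all subgraphs isomorphic to cubes (vertices, edges,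 induced 4-cycles, 3-cubes, etc.) by solid unit cubes. For a vertex $x$, $\mathrm{Link}(x)$ is the graph whose vertices are the 1-cells (edges of $G$) containing $x$, two of them being adjacent iff they lie in a common 2-cell (i.e. a common 4-cycle of $G$). $\mathrm{Link}(|G|)$ is the union of the graphs $\mathrm{Link}(x)$ over all vertices $x$: its vertices are the edges of $G$, two of them being adjacent iff they share an endpoint and lie in a common 2-cell. *)

(* Defs.v *)
From mathcomp Require Import all_boot.
From mathcomp Require Import boolp classical_sets functions cardinality.

Set Implicit Arguments.
Unset Strict Implicit.
Unset Printing Implicit Defensive.

Local Open Scope classical_set_scope.

(* Vertex types are arbitrary, hence possibly infinite; a boolean edge relation
   loses no generality since any proposition can be turned into a boolean by
   the classical `[< _ >]. *)
Record sgraph := SGraph {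
  vertex :> Type;
  adj : rel vertex;
  adj_sym : symmetric adj;
  adj_irrefl : irreflexive adj }.

Definition walk (G : sgraph) (x y : G) (n : nat) : Prop :=
  exists p : seq G, [/\ path (@adj G) x p, last x p = y & size p = n].

Definition connected_graph (G : sgraph) : Prop :=
  forall x y : G, exists n, walk x y n.

(* Vertices in different components get the dummy value 0. As a true distance
   0 only occurs between equal vertices, this cannot be mistaken for the
   distance between two distinct vertices of a connected graph. *)
Definition dist (G : sgraph) (x y : G) : nat :=
  if pselect (exists n, `[< walk x y n >]) is left ex_walk
  then ex_minn ex_walk else 0.

Definition induced_embedding (H G : sgraph) (f : H -> G) : Prop :=
  injective f /\ {mono f : x y / adj x y}.

Definition isometric_embedding (H G : sgraph) (f : H -> G) : Prop :=
  induced_embedding f /\ {mono f : x y / dist x y}.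

(* The subgraph relation is understood up to isomorphism. *)
Definition isometric_subgraph (H G : sgraph) : Prop :=
  exists f : H -> G, isometric_embedding f.

Definition bipartite (G : sgraph) : Prop :=
  exists c : G -> bool, forall x y, adj x y -> c x != c y.

Definition ginterval (G : sgraph) (x y : G) : set G :=
  [set z | dist x y = dist x z + dist z y].

Definition is_median (G : sgraph) (x y z m : G) : Prop :=
  ginterval x y `&` ginterval y z `&` ginterval z x = [set m].

Definition median_graph (G : sgraph) : Prop :=
  connected_graph G /\ forall x y z : G, exists m, is_median x y z m.

Definition median_closed (H : sgraph) (Y : set H) : Prop :=
  forall x y z m, Y x -> Y y -> Y z -> is_median x y z m -> Y m.

Definition median_subgraph (G H : sgraph) : Prop :=
  median_graph H /\
  exists f : G -> H, isometric_embedding f /\ median_closed (range f).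

(* Cycle C_n; only meaningful for n >= 3. *)
Section Cycle.
Variable n : nat.

Definition cycle_adj : rel 'I_n := fun i j =>
  (i != j) && ((j == i.+1 %% n :> nat) || (i == j.+1 %% n :> nat)).

Lemma cycle_adj_sym : symmetric cycle_adj.
Proof. by move=> i j; rewrite /cycle_adj eq_sym orbC. Qed.

Lemma cycle_adj_irrefl : irreflexive cycle_adj.
Proof. by move=> i; rewrite /cycle_adj eqxx. Qed.

Definition cycle_graph := SGraph cycle_adj_sym cycle_adj_irrefl.
End Cycle.

Section CompleteBipartite.
Variables m n : nat.

Definition complete_bipartite_adj : rel ('I_m + 'I_n) := fun u v =>
  match u, v with inl _, inr _ | inr _, inl _ => true | _, _ => false end.

Lemma complete_bipartite_adj_sym : symmetric complete_bipartite_adj.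
Proof. by move=> [?|?] [?|?]. Qed.

Lemma complete_bipartite_adj_irrefl : irreflexive complete_bipartite_adj.
Proof. by case. Qed.

Definition complete_bipartite :=
  SGraph complete_bipartite_adj_sym complete_bipartite_adj_irrefl.
End CompleteBipartite.

(* The absence of cycles refers to arbitrary, not just induced, subgraphs. *)
Definition acyclic (G : sgraph) : Prop :=
  forall n, 3 <= n -> ~ exists f : cycle_graph n -> G,
    injective f /\ {homo f : i j / adj i j}.

Definition tree (T : sgraph) : Prop := connected_graph T /\ acyclic T.

Section CartesianProduct.
Variables G H : sgraph.

Definition cartesian_adj : rel (G * H) := fun u v =>
  `[< (u.1 = v.1 /\ adj u.2 v.2) \/ (adj u.1 v.1 /\ u.2 = v.2) >].

Lemma cartesian_adj_sym : symmetric cartesian_adj.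
Proof.
move=> u v; apply: asbool_equiv_eq; rewrite (adj_sym u.1) (adj_sym u.2).
by split=> -[[-> ->]|[-> ->]]; [left|right|left|right].
Qed.

Lemma cartesian_adj_irrefl : irreflexive cartesian_adj.
Proof. by move=> u; apply/asboolP; rewrite !adj_irrefl => -[[]|[]]. Qed.

Definition cartesian := SGraph cartesian_adj_sym cartesian_adj_irrefl.
End CartesianProduct.

Definition partial_double_tree (G : sgraph) : Prop :=
  exists T1 T2 : sgraph,
    [/\ tree T1, tree T2 & isometric_subgraph G (cartesian T1 T2)].

Section InducedSubgraph.
Variables (G : sgraph) (Y : set G).

Definition induced_adj : rel {x : G | Y x} := fun u v => adj (sval u) (sval v).

Lemma induced_adj_sym : symmetric induced_adj.
Proof. by move=> u v; apply: adj_sym. Qed.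

Lemma induced_adj_irrefl : irreflexive induced_adj.
Proof. by move=> u; apply: adj_irrefl. Qed.

Definition induced := SGraph induced_adj_sym induced_adj_irrefl.
End InducedSubgraph.

Definition differ_by_one (X : Type) (A B : set X) : Prop :=
  exists x, A `+` B = [set x].

(* The graph common to hypercubes and simplex graphs: a family of subsets of X,
   two of them being adjacent when they differ in exactly one element. *)
Section SetFamily.
Variables (X : Type) (F : set (set X)).

Definition family_adj : rel {A : set X | F A} := fun A B =>
  `[< differ_by_one (sval A) (sval B) >].

Lemma family_adj_sym : symmetric family_adj.
Proof.
by move=> A B; apply: asbool_equiv_eq; rewrite /differ_by_one /setY setUC.
Qed.

Lemma family_adj_irrefl : irreflexive family_adj.
Proof.
move=> A; apply/asboolP => -[x AAx].
have : [set x] x by [].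
by rewrite -AAx => -[[]|[]].
Qed.

Definition family_graph := SGraph family_adj_sym family_adj_irrefl.
End SetFamily.

Definition hypercube (X : Type) : sgraph := family_graph (@finite_set X).

Definition clique (F : sgraph) (K : set F) : Prop :=
  forall x y, K x -> K y -> x <> y -> adj x y.

Definition simplex_graph (F : sgraph) : sgraph := family_graph (@clique F).

Definition Q3_minus (v : hypercube 'I_3) : sgraph :=
  induced [set u : hypercube 'I_3 | u <> v].

Definition convex (G : sgraph) (Y : set G) : Prop :=
  forall x y, Y x -> Y y -> ginterval x y `<=` Y.

(* A split is an unordered pair of halves, hence a set of sets of vertices. *)
Definition convex_split (G : sgraph) (P : set (set G)) : Prop :=
  exists A B : set G,
    [/\ P = [set A; B], A !=set0 /\ B !=set0,
        A `&` B = set0, A `|` B = setT & convex A /\ convex B].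

Definition incompatible (G : sgraph) (P Q : set (set G)) : Prop :=
  forall A B, P A -> Q B -> A `&` B !=set0.

Section IncompatibilityGraph.
Variable G : sgraph.

Definition Inc_adj : rel {P : set (set G) | convex_split P} := fun P Q =>
  `[< incompatible (sval P) (sval Q) >].

Lemma Inc_adj_sym : symmetric Inc_adj.
Proof.
by move=> P Q; apply: asbool_equiv_eq; split=> PQ A B ? ?; rewrite setIC;
  apply: PQ.
Qed.

Lemma Inc_adj_irrefl : irreflexive Inc_adj.
Proof.
move=> P; apply/asboolP; case: (svalP P) => A [B [PAB _ AB0 _ _]] /(_ A B).
by rewrite PAB AB0 => /(_ (or_introl erefl) (or_intror erefl)) [].
Qed.

Definition Inc := SGraph Inc_adj_sym Inc_adj_irrefl.
End IncompatibilityGraph.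

(* 1-cells and 2-cells are represented by their vertex sets. A 2-cell is an
   induced 4-cycle, so an edge of the graph is a side of the cell exactly when
   its two endpoints are in the cell. *)
Definition is_edge (G : sgraph) (e : set G) : Prop :=
  exists x y, adj x y /\ e = [set x; y].

Definition two_cell (G : sgraph) (S : set G) : Prop :=
  exists f : cycle_graph 4 -> G, induced_embedding f /\ S = range f.

Definition common_two_cell (G : sgraph) (e e' : set G) : Prop :=
  exists S, [/\ two_cell S, e `<=` S & e' `<=` S].

Section Link.
Variables (G : sgraph) (x : G).

Definition Link_adj : rel {e : set G | is_edge e /\ e x} := fun e e' =>
  `[< sval e <> sval e' /\ common_two_cell (sval e) (sval e') >].

Lemma Link_adj_sym : symmetric Link_adj.
Proof.
by move=> e e'; apply: asbool_equiv_eq; split=> -[ne [S [? ? ?]]];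
  (split; [exact: nesym|exists S]).
Qed.

Lemma Link_adj_irrefl : irreflexive Link_adj.
Proof. by move=> e; apply/asboolP => -[]. Qed.

Definition Link := SGraph Link_adj_sym Link_adj_irrefl.
End Link.

Section LinkComplex.
Variable G : sgraph.

(* The union over all x of the edge sets of the graphs Link x *)
Definition Link_complex_adj : rel {e : set G | is_edge e} := fun e e' =>
  `[< exists (x : G) (a b : Link x),
        [/\ sval a = sval e, sval b = sval e' & adj a b] >].

Lemma Link_complex_adj_sym : symmetric Link_complex_adj.
Proof.
by move=> e e'; apply: asbool_equiv_eq; split=> -[x [a [b [ae be ab]]]];
  exists x, b, a; rewrite adj_sym.
Qed.

Lemma Link_complex_adj_irrefl : irreflexive Link_complex_adj.
Proof.
by move=> e; apply/asboolP => -[x [a [b [ae be /asboolP[+ _]]]]]; rewrite ae be.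
Qed.

Definition Link_complex := SGraph Link_complex_adj_sym Link_complex_adj_irrefl.
End LinkComplex.

(* Main.v *)
(* A halfspace of a median graph is determined by any edge that crosses it, and
   two splits are incompatible exactly when they cross a common 4-cycle. Hence
   2-colourings of Inc(G) are 2-colourings of the edges in which adjacent edges
   of a 4-cycle differ, that is, 2-colourings of Link(|G|). Colourings of the
   individual links can be flipped so as to agree along edges: the obstruction
   is a mod 2 cocycle on edges that vanishes on 4-cycles, and such cocycles are
   coboundaries by the quadrangle condition. If some link is not bipartite, a
   shortest odd cycle in it spans an isometric Q_3 - v or kappa(C_{2k+1}).

   Given a 2-colouring of Inc(G), the splits of one colour are pairwise
   compatible, so that they are the edges of a tree; recording on which side of
   the splits of each colour a vertex lies embeds G into the product of the two
   trees.

   If G has no isometric C_3 or C_n with n >= 5, then every triple has a median: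
   in a triple of minimal perimeter without a median, the three sides would form
   an isometric cycle. Two medians of a triple yield K_{2,3} or an isometric C_6. *)

(* The obstacle is that a partial double tree is not known to have medians: an isometric subgraph of
   a median graph, such as the hexagon in Q_3, need not be median. Medians are therefore recovered
   from excluded subgraphs. The product of the two trees is median with bipartite [Inc], so it omits
   every obstruction; omission passes to isometric subgraphs, and a graph that omits them all is
   median.

   Both kinds of obstruction are one family, the cogwheels [cog n] with n odd: a hub, n spokes
   around it, and n rim vertices closing the squares between consecutive spokes. For n >= 4 the
   cliques of C_n are the empty set, the vertices and the edges, so [cog n] is kappa(C_n). For n = 3
   the triangle is a further clique: kappa(C_3) is all of Q_3, and [cog 3] is Q_3 with one vertex
   missing. This is why Q_3 - v stands apart and the simplex graphs start at C_5.

   In infinite graphs the vertices of the hypercube stay finite sets because only the halves that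
   separate a vertex from a fixed base vertex are recorded. *)
Require Import Defs.
From mathcomp Require Import all_boot finmap zify.
From mathcomp Require Import boolp classical_sets functions cardinality.

Set Implicit Arguments.
Unset Strict Implicit.
Unset Printing Implicit Defensive.

Local Open Scope classical_set_scope.

(** * Walks, distances and isometric embeddings *)

Section Walks.
Variable G : sgraph.
Implicit Types x y z : G.

Lemma walk0 x : walk x x 0.
Proof. by exists [::]. Qed.

Lemma walk0_eq x y : walk x y 0 -> x = y.
Proof. by move=> [[|? ?] [_ /= <- //]]. Qed.

Lemma walkS x y z n : adj x y -> walk y z n -> walk x z n.+1.
Proof. by move=> xy [p [pp <- <-]]; exists (y :: p); split; rewrite /= ?xy. Qed.

Lemma walkS_inv x z n : walk x z n.+1 -> exists2 y, adj x y & walk y z n.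
Proof. by move=> [[|y p] [//= /andP[xy yp] <- [<-]]]; exists y => //; exists p. Qed.

Lemma walk1 x y : adj x y -> walk x y 1.
Proof. by move=> xy; apply: walkS xy (walk0 y). Qed.

Lemma walk1_adj x y : walk x y 1 -> adj x y.
Proof. by move=> /walkS_inv[z xz /walk0_eq <-]. Qed.

Lemma walk_cat x y z m n : walk x y m -> walk y z n -> walk x z (m + n).
Proof.
elim: m x => [|m IHm] x; first by move=> /walk0_eq ->.
by move=> /walkS_inv[u xu uy] yz; apply: walkS xu (IHm _ uy yz).
Qed.

Lemma walk_sym x y n : walk x y n -> walk y x n.
Proof.
elim: n x => [|n IHn] x; first by move=> /walk0_eq ->; apply: walk0.
move=> /walkS_inv[u xu /IHn yu]; rewrite -addn1; apply: walk_cat yu _.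
by apply: walk1; rewrite adj_sym.
Qed.

Lemma walk_fun (p : nat -> G) m n :
  (forall i, m <= i < m + n -> adj (p i) (p i.+1)) -> walk (p m) (p (m + n)) n.
Proof.
elim: n m => [|n IHn] m pP; first by rewrite addn0; apply: walk0.
apply: walkS (pP m _) _; first by lia.
by rewrite addnS -addSn; apply: IHn => i im; apply: pP; lia.
Qed.

Lemma dist_le x y n : walk x y n -> dist x y <= n.
Proof.
move=> xyn; rewrite /dist; case: pselect => // ex_walk.
by case: ex_minnP => m _; apply; apply/asboolP.
Qed.

End Walks.

Lemma walk_hom (G H : sgraph) (f : G -> H) x y n :
  {homo f : u v / adj u v} -> walk x y n -> walk (f x) (f y) n.
Proof.
move=> fhom; elim: n x => [|n IHn] x; first by move=> /walk0_eq ->; apply: walk0.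
by move=> /walkS_inv[z /fhom xz /IHn]; apply: walkS.
Qed.

(** The source of all lower bounds on distances: a function that drops by at most one along edges
    bounds the length of a walk from below. It serves for cycles, products and hypercubes. *)
Lemma walk_lipschitz (G : sgraph) (h : G -> nat) x y n :
  (forall u v, adj u v -> h u <= (h v).+1) -> walk x y n -> h x <= h y + n.
Proof.
move=> hL; elim: n x => [|n IHn] x; first by move=> /walk0_eq ->; rewrite addn0.
by move=> /walkS_inv[z /hL xz /IHn]; lia.
Qed.

Section Distance.
Variables (G : sgraph) (Gc : connected_graph G).
Implicit Types x y z u v w : G.

Lemma dist_walk x y : walk x y (dist x y).
Proof.
rewrite /dist; case: pselect => [ex_walk|nex].
  by case: ex_minnP => m /asboolP.
by case: (Gc x y) => n xyn; case: nex; exists n; apply/asboolP.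
Qed.

Lemma distxx x : dist x x = 0.
Proof. by apply/eqP; rewrite -leqn0; apply: dist_le; apply: walk0. Qed.

Lemma dist0_eq x y : dist x y = 0 -> x = y.
Proof. by move=> xy0; apply: walk0_eq; rewrite -xy0; apply: dist_walk. Qed.

Lemma dist_gt0 x y : x <> y -> 0 < dist x y.
Proof. by rewrite lt0n => xy; apply/eqP => /dist0_eq. Qed.

Lemma distC x y : dist x y = dist y x.
Proof.
by apply/eqP; rewrite eqn_leq; apply/andP; split;
  apply: dist_le; apply: walk_sym; apply: dist_walk.
Qed.

Lemma dist_triangle y x z : dist x z <= dist x y + dist y z.
Proof. by apply: dist_le; apply: walk_cat; apply: dist_walk. Qed.

Lemma dist1_adj x y : dist x y = 1 -> adj x y.
Proof. by move=> xy; apply: walk1_adj; rewrite -xy; apply: dist_walk. Qed.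

Lemma adj_neq x y : adj x y -> x <> y.
Proof. by move=> xy xEy; rewrite xEy adj_irrefl in xy. Qed.

Lemma adj_dist x y : adj x y -> dist x y = 1.
Proof.
move=> xy; have := dist_le (walk1 xy); have := dist_gt0 (adj_neq xy); lia.
Qed.

Lemma adj_distl x y z : adj y z -> dist x y <= (dist x z).+1.
Proof.
move=> yz; have := dist_triangle z x y.
by rewrite [dist z y]distC (adj_dist yz) addn1.
Qed.

Lemma dist_split x y m n : dist x y = m + n ->
  exists z, dist x z = m /\ dist z y = n.
Proof.
move=> xymn; have := dist_walk x y; rewrite xymn => -[p [xp lp sp]].
exists (last x (take m p)).
have p1 : walk x (last x (take m p)) m.
  exists (take m p); split=> //; last by rewrite size_takel ?sp ?leq_addr.
  by move: xp; rewrite -{1}(cat_take_drop m p) cat_path => /andP[].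
have p2 : walk (last x (take m p)) y n.
  exists (drop m p); split; last by rewrite size_drop sp addKn.
    by move: xp; rewrite -{1}(cat_take_drop m p) cat_path => /andP[].
  by rewrite -last_cat cat_take_drop.
have := dist_le p1; have := dist_le p2.
by have := dist_triangle (last x (take m p)) x y; rewrite xymn; lia.
Qed.

Lemma dist_step x y : x <> y -> exists2 z, adj x z & dist x y = (dist z y).+1.
Proof.
move=> /dist_gt0 xy; have [|z [xz zy]] := @dist_split x y 1 (dist x y).-1.
  by lia.
by exists z; [apply: dist1_adj|lia].
Qed.

(** Every segment of a shortest walk is shortest, since a shortcut would shorten the whole walk. *)
Lemma geodesic x y : exists p : nat -> G,
  [/\ p 0 = x, p (dist x y) = y &
   forall i j, i <= j <= dist x y -> dist (p i) (p j) = j - i].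
Proof.
have [p [xp lp sp]] := dist_walk x y.
pose q i := last x (take i p).
have q0 : q 0 = x by rewrite /q take0.
have qn : q (dist x y) = y by rewrite /q -sp take_size.
have qS i : i < dist x y -> adj (q i) (q i.+1).
  rewrite -sp => ip; rewrite /q -(cat_take_drop i p) in xp *.
  rewrite cat_take_drop (take_nth x ip) last_rcons.
  by move: xp; rewrite (drop_nth x ip) cat_path /= => /and3P[].
exists q; split=> // i j /andP[ij jn].
have w i' j' : i' <= j' <= dist x y -> dist (q i') (q j') <= j' - i'.
  move=> ij'; apply: dist_le.
  have -> : q j' = q (i' + (j' - i')) by congr q; lia.
  by apply: walk_fun => k kP; apply: qS; lia.
have := w 0 i; have := w i j; have := w j (dist x y).
rewrite q0 qn => w1 w2 w3.
have := dist_triangle (q i) x y; have := dist_triangle (q j) (q i) y.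
lia.
Qed.

End Distance.

(* Homomorphisms do not increase distances, hence only the converse is asked. *)
Lemma isometric_embeddingP (H G : sgraph) (f : H -> G) : connected_graph G ->
  {homo f : u v / adj u v} ->
  (forall x y, walk x y (dist (f x) (f y))) -> isometric_embedding f.
Proof.
move=> Gc fhom fw.
have Hc : connected_graph H by move=> x y; eexists; apply: fw.
have dE x y : dist (f x) (f y) = dist x y.
  apply/eqP; rewrite eqn_leq dist_le ?(dist_le (fw _ _)) //.
  by apply: walk_hom => //; apply: dist_walk.
split; last by move=> x y; rewrite dE.
split=> [x y fxy|x y].
  by apply: walk0_eq; rewrite -(distxx (f y)) -{1}fxy; apply: fw.
apply/idP/idP => [fxy|]; last exact: fhom.
by apply: walk1_adj; rewrite -(adj_dist Gc fxy); apply: fw.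
Qed.

Lemma isometric_embedding_comp (F G H : sgraph) (f : F -> G) (g : G -> H) :
  isometric_embedding f -> isometric_embedding g ->
  isometric_embedding (g \o f).
Proof.
move=> [[fi fa] fd] [[gi ga] gd]; split; [split|] => [|x y|x y] /=.
- exact: inj_comp.
- by rewrite ga fa.
- by rewrite gd fd.
Qed.

Lemma isometric_subgraph_trans (F G H : sgraph) :
  isometric_subgraph F G -> isometric_subgraph G H -> isometric_subgraph F H.
Proof.
by move=> [f fi] [g gi]; exists (g \o f); apply: isometric_embedding_comp.
Qed.

Lemma isometric_embedding_id (G : sgraph) : isometric_embedding (@id G).
Proof. by split; [split|] => [x y|x y|x y]. Qed.

(** Neither map increases distances, so a loss in [f] could not be made up by [g]. *)
Lemma isometric_embedding_factor (F G H : sgraph) (f : F -> G) (g : G -> H) :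
  connected_graph F -> connected_graph G ->
  {homo f : u v / adj u v} -> {homo g : u v / adj u v} ->
  isometric_embedding (g \o f) -> isometric_embedding f.
Proof.
move=> Fc Gc fhom ghom [_ gfd]; apply: isometric_embeddingP => // x y.
suff -> : dist (f x) (f y) = dist x y by apply: dist_walk.
apply/eqP; rewrite eqn_leq; apply/andP; split.
  exact/dist_le/(walk_hom fhom)/(dist_walk Fc).
by rewrite -gfd; apply/dist_le/(walk_hom ghom)/(dist_walk Gc).
Qed.

(** * Distances in cycles *)

Section Cycles.
Variable n : nat.
Hypothesis n_gt2 : 2 < n.

Lemma cycle_adjP (i j : 'I_n) :
  reflect (i.+1 = j \/ j.+1 = i \/ (i = 0 :> nat /\ j.+1 = n) \/
           (j = 0 :> nat /\ i.+1 = n))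
          (@cycle_adj n i j).
Proof.
have modS (k : 'I_n) : k.+1 %% n = if k.+1 == n then 0 else k.+1.
  have := ltn_ord k; case: eqP => [->|kn kn']; first by rewrite modnn.
  by rewrite modn_small //; lia.
rewrite /cycle_adj -val_eqE /= !modS.
have := ltn_ord i; have := ltn_ord j.
by case: (i.+1 =P n) => iE; case: (j.+1 =P n) => jE jn ni; apply: (iffP idP); lia.
Qed.

Lemma walk_cycle_le (i j : cycle_graph n) : (i <= j)%N -> walk i j (j - i).
Proof.
move=> ij; have n0 : 0 < n by lia.
pose p k : cycle_graph n := insubd (i : 'I_n) k.
have pE k : k < n -> p k = k :> nat by move=> kn; rewrite /p val_insubd kn.
have pK (k : 'I_n) : p k = k by apply: val_inj; apply: pE (ltn_ord k).
have := @walk_fun (cycle_graph n) p i (j - i).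
rewrite subnKC // !pK; apply=> k kP; have := ltn_ord j => jn.
have k1 : k < n by lia.
have k2 : k.+1 < n by lia.
by apply/cycle_adjP; rewrite (pE _ k1) (pE _ k2); left.
Qed.

Lemma walk_cycle_ge (i j : cycle_graph n) : (i <= j)%N -> walk i j (n - (j - i)).
Proof.
move=> ij; have n0 : 0 < n by lia.
have ni := ltn_ord i; have nj := ltn_ord j.
pose z : cycle_graph n := Ordinal n0.
have nn : n.-1 < n by lia.
pose t : cycle_graph n := Ordinal nn.
have w1 := walk_sym (@walk_cycle_le z i isT).
have jt : j <= t by rewrite /=; lia.
have w2 := walk_sym (walk_cycle_le jt).
have zt : adj z t by apply/cycle_adjP => /=; lia.
have -> : n - (j - i) = (i - z) + (t - j).+1 by rewrite /=; lia.
by apply: walk_cat w1 _; apply: walkS zt w2.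
Qed.

(** One of the two truncated differences vanishes, so their sum is the absolute difference of i and
    j; the minimum is over the two arcs between them. *)
Definition cycle_dist (i j : nat) :=
  minn ((i - j) + (j - i)) (n - ((i - j) + (j - i))).

Lemma walk_cycle (i j : cycle_graph n) : walk i j (cycle_dist i j).
Proof.
wlog ij : i j / (i <= j)%N => [th|].
  case/orP: (leq_total i j) => ij; first exact: th.
  by rewrite /cycle_dist addnC; apply: walk_sym; apply: th.
rewrite /cycle_dist /minn; case: ifP => _; have -> : i - j + (j - i) = j - i by lia.
- exact: walk_cycle_le.
- exact: walk_cycle_ge.
Qed.

Lemma cycle_connected : connected_graph (cycle_graph n).
Proof. by move=> i j; eexists; apply: walk_cycle. Qed.

Lemma dist_cycle (i j : cycle_graph n) : dist i j = cycle_dist i j.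
Proof.
apply/eqP; rewrite eqn_leq (dist_le (walk_cycle i j)) /=.
have := @walk_lipschitz (cycle_graph n) (fun k => cycle_dist k j) i j (dist i j).
rewrite [cycle_dist j j](_ : _ = 0); last by rewrite /cycle_dist; lia.
apply; last exact: dist_walk cycle_connected _ _.
move=> u v /cycle_adjP uv; rewrite /cycle_dist.
have := ltn_ord u; have := ltn_ord v; have := ltn_ord j; lia.
Qed.

Lemma isometric_cycle (G : sgraph) (p : nat -> G) : connected_graph G ->
  (forall i j, i <= j < n -> dist (p i) (p j) = minn (j - i) (n - (j - i))) ->
  isometric_subgraph (cycle_graph n) G.
Proof.
move=> Gc pd; exists (fun i : 'I_n => p i).
have pd' (i j : 'I_n) : dist (p i) (p j) = cycle_dist i j.
  have := ltn_ord i; have := ltn_ord j; rewrite /cycle_dist.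
  case/orP: (leq_total i j) => ij jn ni; last rewrite distC //.
    by rewrite pd; lia.
  by rewrite pd; lia.
apply: isometric_embeddingP => // [i j ij|i j].
  apply: (dist1_adj Gc); rewrite pd' -dist_cycle.
  exact: adj_dist cycle_connected _ _ ij.
by rewrite pd'; apply: walk_cycle.
Qed.

End Cycles.

(** * Modular and median graphs *)

(** Membership of m in the three intervals without the uniqueness built into [is_median], so that
    existence and uniqueness can be treated apart. *)
Definition median3 (G : sgraph) (x y z m : G) : Prop :=
  [/\ dist x y = dist x m + dist m y, dist y z = dist y m + dist m z
    & dist z x = dist z m + dist m x].

Lemma is_medianP (G : sgraph) (x y z m : G) :
  is_median x y z m <->
  median3 x y z m /\ forall m', median3 x y z m' -> m' = m.
Proof.
rewrite /is_median; split=> [mE|[[m1 m2 m3] mU]].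
  split=> [|m' [? ? ?]].
    by have : [set m] m by []; rewrite -mE => -[[]].
  by have : [set m] m' by rewrite -mE.
apply/seteqP; split=> [m' [[? ?] ?]|_ ->] /=; first exact: mU.
by [].
Qed.

(* Distances are symmetric, so [lia] is given every instance of symmetry. *)
Ltac dist_lia Gc :=
  repeat match goal with
  | _ : context [@dist ?G ?x ?y] |- _ =>
    lazymatch goal with
    | _ : @dist G x y = @dist G y x |- _ => fail
    | _ : @dist G y x = @dist G x y |- _ => fail
    | _ => pose proof (distC Gc x y)
    end
  | |- context [@dist ?G ?x ?y] =>
    lazymatch goal with
    | _ : @dist G x y = @dist G y x |- _ => fail
    | _ : @dist G y x = @dist G x y |- _ => fail
    | _ => pose proof (distC Gc x y)
    end
  end; lia.

(** Medians exist but may fail to be unique, as in K_{2,3}. Existence alone already gives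
    bipartiteness and the quadrangle condition. *)
Definition modular (G : sgraph) : Prop :=
  forall x y z : G, exists m, median3 x y z m.

Section Modular.
Variables (G : sgraph) (Gc : connected_graph G) (Gm : modular G).
Implicit Types x y z u v w m p q r s : G.

(** A median of w, u, v lies on the edge u v, so it is u or v, and that endpoint is on a geodesic
    from w to the other. In particular the graph is bipartite. *)
Lemma adj_parity w u v : adj u v ->
  dist w u = (dist w v).+1 \/ dist w v = (dist w u).+1.
Proof.
move=> uv; have [m [wu uvm vw]] := Gm w u v.
move: uvm; rewrite (adj_dist Gc uv).
case: (posnP (dist u m)) => [/(dist0_eq Gc) um|um uvm].
  by move=> _; subst m; have := adj_dist Gc uv; dist_lia Gc.
have /(dist0_eq Gc) mv : dist m v = 0 by lia.
by subst m; have := adj_dist Gc uv; dist_lia Gc.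
Qed.

Lemma triangle_free x y z : adj x y -> adj y z -> ~ adj x z.
Proof.
move=> xy yz xz; have := adj_parity x yz.
by rewrite (adj_dist Gc xy) (adj_dist Gc xz); lia.
Qed.

Lemma common_neighbor_dist z x y : adj z x -> adj z y -> x <> y -> dist x y = 2.
Proof.
move=> zx zy /(dist_gt0 Gc) xy; have := adj_parity x zy.
by have := adj_dist Gc zx; dist_lia Gc.
Qed.

Lemma dist3 y x z : adj x y -> dist y z = 2 -> ~ adj x z -> dist x z = 3.
Proof.
move=> xy yz xz; have := adj_parity z xy.
by have := @dist1_adj _ Gc x z; dist_lia Gc.
Qed.

(** The vertices v and w are at distance 2, so a median of v, w, u is adjacent to both and one step
    nearer to u. *)
Lemma quadrangle u z v w : adj z v -> adj z w -> v <> w ->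
  dist u z = (dist u v).+1 -> dist u z = (dist u w).+1 ->
  exists s, [/\ adj s v, adj s w & dist u v = (dist u s).+1].
Proof.
move=> zv zw vw uv uw; have [s [d1 d2 d3]] := Gm v w u.
have d4 := common_neighbor_dist zv zw vw.
have d5 : dist v s = 1 by dist_lia Gc.
have d6 : dist w s = 1 by dist_lia Gc.
exists s; split; [rewrite adj_sym..|]; try exact: (dist1_adj Gc).
by dist_lia Gc.
Qed.

Lemma isometric_K23 m s p q r : m <> s -> p <> q -> p <> r -> q <> r ->
  adj m p -> adj m q -> adj m r -> adj s p -> adj s q -> adj s r ->
  isometric_subgraph (complete_bipartite 2 3) G.
Proof.
move=> ms pq pr qr mp mq mr sp sq sr.
pose f (i : complete_bipartite 2 3) : G := match i with
  | inl i => if i == 0 :> nat then m else s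
  | inr i => if i == 0 :> nat then p else if i == 1 :> nat then q else r
  end.
exists f; have fhom : {homo f : i j / adj i j}.
  move=> [i|i] [j|j] //= _; do 3?case: ifP => _ //; by rewrite adj_sym.
apply: isometric_embeddingP => // x y.
have w2 (i j : 'I_2) : walk (inl i : complete_bipartite 2 3) (inl j) 2.
  by exists [:: inr ord0; inl j].
have w3 (i j : 'I_3) : walk (inr i : complete_bipartite 2 3) (inr j) 2.
  by exists [:: inl ord0; inr j].
case: (pselect (x = y)) => [->|xy].
  by rewrite (distxx (f y)); apply: walk0.
case: x y xy => [i|i] [j|j] xy; last 1 first.
- suff -> : dist (f (inr i)) (f (inr j)) = 2 by [].
  suff fij : f (inr i) <> f (inr j).
    by apply: (@common_neighbor_dist m) fij => /=; do 2?case: ifP.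
  case: i j xy => [[|[|[|//]]] ip] [[|[|[|//]]] jp] //= xy;
    by [exact: nesym|case: xy; rewrite (bool_irrelevance ip jp)].
- suff -> : dist (f (inl i)) (f (inl j)) = 2 by [].
  suff fij : f (inl i) <> f (inl j).
    apply: (@common_neighbor_dist p) fij => /=; rewrite adj_sym; by case: ifP.
  case: i j xy => [[|[|//]] ip] [[|[|//]] jp] //= xy;
    by [exact: nesym|case: xy; rewrite (bool_irrelevance ip jp)].
- by rewrite (adj_dist Gc (fhom (inl i) (inr j) isT)); apply: walk1.
- by rewrite (adj_dist Gc (fhom (inr i) (inl j) isT)); apply: walk1.
Qed.

(** The hexagon is p, s, q, s'', r, s'. Vertices of one colour class have a common neighbour, hence
    distance 2; opposite vertices are not adjacent, hence at distance 3 by parity. *)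
Lemma isometric_hexagon p q r s s' s'' :
  p <> q -> p <> r -> q <> r ->
  adj s p -> adj s q -> adj s' p -> adj s' r -> adj s'' q -> adj s'' r ->
  ~ adj s r -> ~ adj s' q -> ~ adj s'' p ->
  isometric_subgraph (cycle_graph 6) G.
Proof.
move=> pq pr qr sp sq s1p s1r s2q s2r nsr nsq nsp.
pose c i : G := nth p [:: p; s; q; s''; r; s'] i.
have d1 := common_neighbor_dist sp sq pq.
have d2 := common_neighbor_dist s1p s1r pr.
have d3 := common_neighbor_dist s2q s2r qr.
have ss1 : s <> s' by move=> E; subst s'.
have ss2 : s <> s'' by move=> E; subst s''.
have s12 : s' <> s'' by move=> E; subst s''.
have ps : adj p s by rewrite adj_sym.
have qs : adj q s by rewrite adj_sym.
have ps1 : adj p s' by rewrite adj_sym.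
have rs1 : adj r s' by rewrite adj_sym.
have qs2 : adj q s'' by rewrite adj_sym.
have rs2 : adj r s'' by rewrite adj_sym.
have d4 := common_neighbor_dist ps ps1 ss1.
have d5 := common_neighbor_dist qs qs2 ss2.
have d6 := common_neighbor_dist rs1 rs2 s12.
have d7 := dist3 sp d2 nsr.
have d8 := dist3 s1p d1 nsq.
have d9 : dist s'' p = 3 by apply: (dist3 s2q) => //; rewrite distC.
have := adj_dist Gc sp; have := adj_dist Gc sq; have := adj_dist Gc s1p.
have := adj_dist Gc s1r; have := adj_dist Gc s2q; have := adj_dist Gc s2r.
move=> e1 e2 e3 e4 e5 e6.
apply: (@isometric_cycle 6 isT _ c) => // i j.
by case: i j => [|[|[|[|[|[|i]]]]]] [|[|[|[|[|[|j]]]]]] //= ij;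
  first [by move: ij; rewrite andbF|exact: distxx|etransitivity; [eassumption|reflexivity]
        |rewrite (distC Gc); etransitivity; [eassumption|reflexivity]].
Qed.

End Modular.

Lemma median3_rot (G : sgraph) (x y z m : G) :
  median3 x y z m -> median3 y z x m.
Proof. by case. Qed.

Section MinimalTriple.
Variables (G : sgraph) (Gc : connected_graph G).
Implicit Types x y z p q m : G.

Definition has_median x y z := exists m, median3 x y z m.

Definition perimeter x y z := dist x y + dist y z + dist z x.

(** If the second alternative fails, the triple x, p, q has smaller perimeter, hence a median m. For
    m = x the walk from p to q through x is a geodesic. Otherwise replacing x by m shortens the
    perimeter by twice [dist x m], and a median of m, y, z is one of x, y, z. *)
Lemma minimal_triple_corner x y z p q :
  (forall u v w, perimeter u v w < perimeter x y z -> has_median u v w) ->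
  ~ has_median x y z ->
  dist x y = dist x p + dist p y -> dist x z = dist x q + dist q z ->
  dist p q = dist p x + dist x q \/
  dist p y + dist y z + dist z q <= dist p q.
Proof.
move=> minP nmed xpy xqz; case: leqP => [|pq]; first by right.
have [|m [m1 m2 m3]] := minP x p q; first by rewrite /perimeter; dist_lia Gc.
case: (pselect (x = m)) => [xm|xm]; first by left; subst m; dist_lia Gc.
have xm0 := dist_gt0 Gc xm.
have t1 := dist_triangle Gc p m y; have t2 := dist_triangle Gc m x y.
have t3 := dist_triangle Gc q m z; have t4 := dist_triangle Gc m x z.
have [|m' [n1 n2 n3]] := minP m y z; first by rewrite /perimeter; dist_lia Gc.
case: nmed; exists m'.
have t5 := dist_triangle Gc m x m'.
have t6 := dist_triangle Gc m' x y; have t7 := dist_triangle Gc m' x z.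
by split; dist_lia Gc.
Qed.

Lemma minimal_triple_cycle x y z :
  (forall u v w, perimeter u v w < perimeter x y z -> has_median u v w) ->
  ~ has_median x y z -> 2 < perimeter x y z ->
  isometric_subgraph (cycle_graph (perimeter x y z)) G.
Proof.
move=> minP nmed L2.
have rotP : perimeter y z x = perimeter x y z by rewrite /perimeter; lia.
have rotP' : perimeter z x y = perimeter x y z by rewrite /perimeter; lia.
have cx p q := @minimal_triple_corner x y z p q minP nmed.
have cy p q : dist y z = dist y p + dist p z -> dist y x = dist y q + dist q x ->
    dist p q = dist p y + dist y q \/
    dist p z + dist z x + dist x q <= dist p q.
  apply: minimal_triple_corner; first by rewrite rotP.
  by move=> [m /median3_rot/median3_rot mm]; apply: nmed; exists m.
have cz p q : dist z x = dist z p + dist p x -> dist z y = dist z q + dist q y ->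
    dist p q = dist p z + dist z q \/
    dist p x + dist x y + dist y q <= dist p q.
  apply: minimal_triple_corner; first by rewrite rotP'.
  by move=> [m /median3_rot mm]; apply: nmed; exists m.
have [al [al0 al1 ald]] := geodesic Gc x y.
have [be [be0 be1 bed]] := geodesic Gc y z.
have [ze [ze0 ze1 zed]] := geodesic Gc z x.
set a := dist x y in al1 ald; set b := dist y z in be1 bed.
set c := dist z x in ze1 zed.
have LE : perimeter x y z = a + b + c by [].
(* The three geodesics run one after the other. Pairs on one side are settled by the triangle
   inequalities, no side being longer than the other two together; pairs on different sides by the
   corner between these sides. *)
pose p i := if i <= a then al i else if i <= a + b then be (i - a)
            else ze (i - a - b).
have aE i : i <= a -> dist x (al i) = i /\ dist (al i) y = a - i.
  by move=> ia; rewrite -{1}al0 -{1}al1 !ald; lia.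
have bE i : i <= b -> dist y (be i) = i /\ dist (be i) z = b - i.
  by move=> ib; rewrite -{1}be0 -{1}be1 !bed; lia.
have cE i : i <= c -> dist z (ze i) = i /\ dist (ze i) x = c - i.
  by move=> ic; rewrite -{1}ze0 -{1}ze1 !zed; lia.
have t1 := dist_triangle Gc z x y; have t2 := dist_triangle Gc x y z.
have t3 := dist_triangle Gc y z x.
have aD : dist x y = a by []. have bD : dist y z = b by [].
have cD : dist z x = c by [].
apply: (isometric_cycle L2 (p := p)) => // i j; rewrite LE => ijL.
rewrite /p; case: (leqP i a) => ia; case: (leqP j a) => ja.
- by rewrite ald; dist_lia Gc.
- have [i1 i2] := aE i ia; case: (leqP j (a + b)) => jb.
  + have [|j1 j2] := bE (j - a); first by lia.
    have := cy (be (j - a)) (al i).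
    have := dist_triangle Gc y (al i) (be (j - a)).
    have := dist_triangle Gc x (al i) (be (j - a)).
    have := dist_triangle Gc z x (be (j - a)).
    by dist_lia Gc.
  + have [|j1 j2] := cE (j - a - b); first by lia.
    have := cx (al i) (ze (j - a - b)).
    have := dist_triangle Gc x (al i) (ze (j - a - b)).
    have := dist_triangle Gc y (al i) (ze (j - a - b)).
    have := dist_triangle Gc z y (ze (j - a - b)).
    by dist_lia Gc.
- by lia.
case: (leqP i (a + b)) => ib; case: (leqP j (a + b)) => jb.
- by rewrite bed; dist_lia Gc.
- have [|i1 i2] := bE (i - a); first by lia.
  have [|j1 j2] := cE (j - a - b); first by lia.
  have := cz (ze (j - a - b)) (be (i - a)).
  have := dist_triangle Gc z (be (i - a)) (ze (j - a - b)).
  have := dist_triangle Gc y (be (i - a)) (ze (j - a - b)).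
  have := dist_triangle Gc x y (ze (j - a - b)).
  by dist_lia Gc.
- by lia.
by rewrite zed; dist_lia Gc.
Qed.

(* In a triple without a median and of minimal perimeter, the three sides form
   an isometric cycle. *)
Lemma modular_of_no_cycle :
  ~ isometric_subgraph (cycle_graph 3) G ->
  (forall k, 2 <= k -> ~ isometric_subgraph (cycle_graph (k + 3)) G) ->
  modular G.
Proof.
move=> noC3 noC.
suff main n x y z : perimeter x y z < n -> has_median x y z.
  by move=> x y z; apply: (main (perimeter x y z).+1).
elim: n x y z => // n IHn x y z; rewrite ltnS => xyzn.
apply: contrapT => nmed.
have minP u v w : perimeter u v w < perimeter x y z -> has_median u v w.
  by move=> uvw; apply: IHn; lia.
have cyc := minimal_triple_cycle minP nmed.
have d0 := @distxx G.
(* Equality would make the third vertex itself a median. *)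
have s1 : dist x y <> dist x z + dist z y.
  by move=> E; apply: nmed; exists z; split; rewrite ?d0; dist_lia Gc.
have s2 : dist y z <> dist y x + dist x z.
  by move=> E; apply: nmed; exists x; split; rewrite ?d0; dist_lia Gc.
have s3 : dist z x <> dist z y + dist y x.
  by move=> E; apply: nmed; exists y; split; rewrite ?d0; dist_lia Gc.
have t1 := dist_triangle Gc z x y; have t2 := dist_triangle Gc x y z.
have t3 := dist_triangle Gc y z x.
(* All triangle inequalities are strict, which excludes perimeter 4: its only triangle with positive
   sides, 1, 1, 2, is degenerate. So C_4 never arises. *)
have L : perimeter x y z = 3 \/ 5 <= perimeter x y z.
  by rewrite /perimeter; dist_lia Gc.
case: L => L; first by apply: noC3; rewrite -L; apply: cyc; rewrite L.
apply: (noC (perimeter x y z - 3)); first by lia.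
by rewrite subnK; [apply: cyc|]; lia.
Qed.

End MinimalTriple.

Section MedianUniqueness.
Variables (G : sgraph) (Gc : connected_graph G) (Gm : modular G).

(* The neighbours p, q, r of m towards x, y, z all lie towards m' too. *)
Lemma median3_unique :
  ~ isometric_subgraph (complete_bipartite 2 3) G ->
  ~ isometric_subgraph (cycle_graph 6) G ->
  forall x y z m m' : G, median3 x y z m -> median3 x y z m' -> m' = m.
Proof.
move=> noK noC x y z m m' [m1 m2 m3] [n1 n2 n3].
apply: contrapT => mm'; have mm0 := dist_gt0 Gc mm'.
(* The distances from a median to x, y, z are determined by the triple, so m and m' are equidistant
   from each of them. A median of u, m, m' is then different from m, and the next vertex towards it
   approaches both u and m'. *)
have nbr u : dist u m = dist u m' -> exists p,
    [/\ adj m p, dist u m = (dist u p).+1 & dist m' m = (dist m' p).+1].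
  move=> um; have [u' [u1 u2 u3]] := Gm u m m'.
  have mu : m <> u' by move=> E; subst u'; have := @distxx G m; dist_lia Gc.
  have [p mp pu] := dist_step Gc mu.
  have t1 := dist_triangle Gc u' u p; have t2 := dist_triangle Gc u' m' p.
  have t3 := dist_triangle Gc p u m; have t4 := dist_triangle Gc p m' m.
  have mp1 := adj_dist Gc mp.
  by exists p; split=> //; dist_lia Gc.
have [|p [mp xp m'p]] := nbr x; first by dist_lia Gc.
have [|q [mq yq m'q]] := nbr y; first by dist_lia Gc.
have [|r [mr zr m'r]] := nbr z; first by dist_lia Gc.
have pq : p <> q.
  by move=> E; subst q; have := dist_triangle Gc p x y; dist_lia Gc.
have pr : p <> r.
  by move=> E; subst r; have := dist_triangle Gc p x z; dist_lia Gc.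
have qr : q <> r.
  by move=> E; subst r; have := dist_triangle Gc q y z; dist_lia Gc.
(* Based at m', the quadrangle condition joins p, q, r in pairs. If one of the three new vertices is
   adjacent to all of p, q, r, it forms a K_{2,3} with m; otherwise the six vertices form a
   hexagon. *)
have [s [sp sq ms]] := quadrangle Gc Gm mp mq pq m'p m'q.
have [s' [s1p s1r ms1]] := quadrangle Gc Gm mp mr pr m'p m'r.
have [s'' [s2q s2r ms2]] := quadrangle Gc Gm mq mr qr m'q m'r.
have mNs t : dist m' p = (dist m' t).+1 -> m <> t.
  by move=> mt E; subst t; lia.
have K t : m <> t -> adj t p -> adj t q -> adj t r -> False.
  by move=> mt tp tq tr; apply: noK; apply: (@isometric_K23 _ Gc Gm m t p q r).
apply: noC; apply: (@isometric_hexagon _ Gc Gm p q r s s' s'') => //.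
- by move=> sr; apply: (K s) => //; apply: mNs.
- by move=> s1q; apply: (K s') => //; apply: mNs.
- by move=> s2p; apply: (K s'') => //; apply: mNs; lia.
Qed.

End MedianUniqueness.

Lemma median_graphP (G : sgraph) : median_graph G <->
  [/\ connected_graph G, modular G &
      forall x y z m m' : G, median3 x y z m -> median3 x y z m' -> m' = m].
Proof.
split=> [[Gc med]|[Gc Gm uniq]]; split=> //.
- by move=> x y z; have [m /is_medianP[mm _]] := med x y z; exists m.
- move=> x y z m m'; have [c /is_medianP[cm cU]] := med x y z.
  by move=> /cU -> /cU ->.
- move=> x y z; have [m mm] := Gm x y z; exists m; apply/is_medianP; split=> //.
  by move=> m' mm'; apply: uniq mm'.
Qed.

Lemma median_graph_of_no_cycle (G : sgraph) : connected_graph G ->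
  ~ isometric_subgraph (cycle_graph 3) G ->
  ~ isometric_subgraph (complete_bipartite 2 3) G ->
  (forall k, 2 <= k -> ~ isometric_subgraph (cycle_graph (k + 3)) G) ->
  median_graph G.
Proof.
move=> Gc noC3 noK noC; have Gm := modular_of_no_cycle Gc noC3 noC.
by apply/median_graphP; split=> //; apply: median3_unique => //; apply: (noC 3).
Qed.

(** * Halfspaces of median graphs *)

Definition halfspace (G : sgraph) (a b : G) : set G :=
  [set x | dist x a < dist x b].

Section Crossing.
Variables (G : sgraph) (Gc : connected_graph G).

(** The edge is the one at which a geodesic from x to y leaves A. Its endpoints lie in the interval,
    so they stay in every convex set that contains x and y. *)
Lemma crossing_edge (A : set G) x y : A x -> ~ A y ->
  exists a b, [/\ adj a b, A a, ~ A b, ginterval x y a & ginterval x y b].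
Proof.
move En : (dist x y) => n; elim: n x En => [|n IHn] x xy Ax nAy.
  by case: nAy; rewrite -(dist0_eq Gc xy).
have [|z xz xyz] := @dist_step _ Gc x y; first by move=> E; case: nAy; rewrite -E.
have xz1 := adj_dist Gc xz.
case: (pselect (A z)) => Az.
  have [|a [b [ab Aa nAb]]] := IHn z _ Az nAy; first by lia.
  rewrite /ginterval /= => za zb; exists a, b; split=> //; rewrite /ginterval /=.
    by have := dist_triangle Gc z x a; have := dist_triangle Gc a x y; dist_lia Gc.
  by have := dist_triangle Gc z x b; have := dist_triangle Gc b x y; dist_lia Gc.
by exists x, z; split=> //; rewrite /ginterval /= ?distxx; lia.
Qed.

End Crossing.

Section Median.
Variables (G : sgraph) (Gmed : median_graph G).
Implicit Types (x y z u v w a b m p q r s : G) (A B : set G).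

Let Gc : connected_graph G := Gmed.1.
Let Gm : modular G. Proof. by have /median_graphP[] := Gmed. Qed.
Let Gu x y z m m' : median3 x y z m -> median3 x y z m' -> m' = m.
Proof. by have /median_graphP[_ _] := Gmed; apply. Qed.

Lemma median_K23_free m s p q r : m <> s -> p <> q -> p <> r -> q <> r ->
  adj m p -> adj m q -> adj m r -> adj s p -> adj s q -> adj s r -> False.
Proof.
move=> ms pq pr qr mp mq mr sp sq sr; apply: ms.
have d1 := common_neighbor_dist Gc Gm mp mq pq.
have d2 := common_neighbor_dist Gc Gm mp mr pr.
have d3 := common_neighbor_dist Gc Gm mq mr qr.
have := adj_dist Gc mp; have := adj_dist Gc mq; have := adj_dist Gc mr.
have := adj_dist Gc sp; have := adj_dist Gc sq; have := adj_dist Gc sr.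
by move=> *; apply: (@Gu p q r); split; dist_lia Gc.
Qed.

Lemma halfspaceE a b x : adj a b ->
  halfspace a b x <-> dist x b = (dist x a).+1.
Proof. by move=> ab; rewrite /halfspace /=; have := adj_parity Gc Gm x ab; lia. Qed.

Lemma halfspaceC a b : adj a b -> ~` halfspace a b = halfspace b a.
Proof.
move=> ab; apply/seteqP; split=> x; rewrite /halfspace /=.
  by have := adj_parity Gc Gm x ab; lia.
by lia.
Qed.

Lemma halfspace_self a b : adj a b -> halfspace a b a.
Proof. by move=> ab; rewrite /halfspace /= distxx (adj_dist Gc ab). Qed.

Lemma halfspace_other a b : adj a b -> ~ halfspace a b b.
Proof. by move=> ab; rewrite /halfspace /= distxx. Qed.

(** The core of convexity: a geodesic that leaves the halfspace along x z cannot come back at y.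
    Otherwise the quadrangle condition yields another leaving edge w y2 that is one step closer to
    y. *)
Lemma halfspace_no_return a b x z y : adj a b ->
  halfspace a b x -> halfspace b a z -> halfspace a b y ->
  adj x z -> dist x y = (dist z y).+1 -> False.
Proof.
move=> ab; have ba : adj b a by rewrite adj_sym.
move En : (dist z y) => n; elim: n x z En => [|n IHn] x z zyn.
  rewrite (dist0_eq Gc zyn) => _ /(halfspaceE _ ba) + /(halfspaceE _ ab); lia.
move=> Wx Wz Wy xz xy.
have Ex := (halfspaceE _ ab).1 Wx; have Ez := (halfspaceE _ ba).1 Wz.
have Ey := (halfspaceE _ ab).1 Wy; have xz1 := adj_dist Gc xz.
have pa := adj_parity Gc Gm a xz; have pb := adj_parity Gc Gm b xz.
have za : dist z a = (dist x a).+1 by dist_lia Gc.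
have zb : dist z b = dist x a by dist_lia Gc.
(* The median m lies between y and a, hence in the halfspace and away from z. A neighbour y2 of z
   towards m therefore approaches y and a at once. *)
have [m [m1 m2 m3]] := Gm y z a.
have Wm : halfspace a b m.
  apply/(halfspaceE _ ab); have := dist_triangle Gc m y b.
  by have := adj_parity Gc Gm m ab; dist_lia Gc.
have zm : z <> m.
  by move=> E; subst m; move/(halfspaceE _ ab): Wm; lia.
have [y2 zy2 zm2] := dist_step Gc zm; have zy21 := adj_dist Gc zy2.
have t1 := dist_triangle Gc m y2 y; have t2 := dist_triangle Gc y2 z y.
have t3 := dist_triangle Gc m y2 a; have t4 := dist_triangle Gc y2 z a.
have y2y : dist z y = (dist y2 y).+1 by dist_lia Gc.
have y2a : dist z a = (dist y2 a).+1 by dist_lia Gc.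
have xy2 : x <> y2 by move=> E; subst y2; lia.
have zx : adj z x by rewrite adj_sym.
have [||w [wx wy2 aw]] := @quadrangle _ Gc Gm a z x y2 zx zy2 xy2;
  [by dist_lia Gc..|].
have wx1 := adj_dist Gc wx; have wy21 := adj_dist Gc wy2.
have Ww : halfspace a b w.
  apply/(halfspaceE _ ab); have := dist_triangle Gc w x b.
  by have := adj_parity Gc Gm w ab; dist_lia Gc.
have Ew := (halfspaceE _ ab).1 Ww.
(* If y2 is back in the halfspace, then w and z are both medians of x, y2, b and coincide, although
   w is nearer to a. *)
case: (pselect (halfspace a b y2)) => [/(halfspaceE _ ab) Ey2|nWy2].
  have xy22 := common_neighbor_dist Gc Gm zx zy2 xy2.
  suff wz : w = z by subst w; dist_lia Gc.
  by apply: (@Gu x y2 b); split; dist_lia Gc.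
apply: (IHn w y2) => //; first by lia.
- by rewrite -(halfspaceC ab).
- have := dist_triangle Gc y2 w y; have := dist_triangle Gc w x y.
  by dist_lia Gc.
Qed.

Lemma halfspace_convex a b : adj a b -> convex (halfspace a b).
Proof.
move=> ab x y + Wy z; rewrite /ginterval /=.
move En : (dist x z) => n; elim: n x En => [|n IHn] x xzn Wx xyz.
  by rewrite -(dist0_eq Gc xzn).
have [|x1 xx1 xz] := @dist_step _ Gc x z.
  by move=> E; subst z; rewrite distxx in xzn.
have xx11 := adj_dist Gc xx1.
have t1 := dist_triangle Gc x1 x y; have t2 := dist_triangle Gc z x1 y.
case: (pselect (halfspace a b x1)) => Wx1.
  by apply: (IHn x1) => //; lia.
case: (@halfspace_no_return a b x x1 y) => //; last by lia.
by rewrite -halfspaceC.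
Qed.

(** A vertex of A nearer to b than to a would have b on a geodesic to a, which forces b into A;
    symmetrically for the complement. So an edge determines the split that it crosses. *)
Lemma convex_halfspace A a b : adj a b ->
  convex A -> convex (~` A) -> A a -> ~ A b -> A = halfspace a b.
Proof.
move=> ab cA cnA Aa nAb; apply/seteqP; split=> x.
  move=> Ax; apply: contrapT => Wx.
  have ba : adj b a by rewrite adj_sym.
  have /(halfspaceE _ ba) xb : halfspace b a x by rewrite -halfspaceC.
  apply: nAb; apply: (cA x a) => //; rewrite /ginterval /=.
  by rewrite (adj_dist Gc ba); lia.
move=> /(halfspaceE _ ab) xa; apply: contrapT => nAx.
have : (~` A) a; last by apply.
apply: (cnA x b) => //; rewrite /ginterval /=.
by rewrite (adj_dist Gc ab); lia.
Qed.

(** Edges across the same split are joined by a strip of squares, of which this is the first. The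
    vertex a1 is a step from a towards a', and b1 comes from the quadrangle condition based at b',
    where b and a1 are one step nearer than a. *)
Lemma ladder a b a' b' : adj a b -> adj a' b' ->
  halfspace a b a' -> halfspace b a b' -> a <> a' ->
  exists a1 b1, [/\ [/\ adj a a1, adj b b1 & adj a1 b1], halfspace a b a1,
    halfspace b a b1 & dist a a' = (dist a1 a').+1].
Proof.
move=> ab a'b' Wa' Wb' aa'.
have ba : adj b a by rewrite adj_sym.
have Ea := (halfspaceE _ ab).1 Wa'; have Eb := (halfspaceE _ ba).1 Wb'.
have pa := adj_parity Gc Gm a a'b'; have pb := adj_parity Gc Gm b a'b'.
have [a1 aa1 d1] := dist_step Gc aa'; have d2 := adj_dist Gc aa1.
have d3 := adj_dist Gc a'b'; have d4 := adj_dist Gc ab.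
have b'b : dist b' b = dist a a' by dist_lia Gc.
have b'a : dist b' a = (dist a a').+1 by dist_lia Gc.
have t1 := dist_triangle Gc a' a1 b'; have t2 := dist_triangle Gc a1 a b'.
have ba1 : b <> a1 by move=> E; subst a1; dist_lia Gc.
have [||b1 [b1b b1a1 d5]] := @quadrangle _ Gc Gm b' a b a1 ab aa1 ba1;
  [by dist_lia Gc..|].
have Wa1 : halfspace a b a1.
  apply: (halfspace_convex ab (halfspace_self ab) Wa').
  by rewrite /ginterval /=; dist_lia Gc.
have Wb1 : halfspace b a b1.
  apply: (halfspace_convex ba (halfspace_self ba) Wb').
  by rewrite /ginterval /=; have := adj_dist Gc b1b; dist_lia Gc.
exists a1, b1; split=> //; split=> //; first by rewrite adj_sym.
by rewrite adj_sym.
Qed.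

Lemma halfspace_eq a b a' b' : adj a b -> adj a' b' ->
  halfspace a b a' -> halfspace b a b' -> halfspace a b = halfspace a' b'.
Proof.
move=> ab a'b' Wa' Wb'; have ba : adj b a by rewrite adj_sym.
apply: convex_halfspace => //; first exact: halfspace_convex.
  by rewrite halfspaceC //; apply: halfspace_convex.
by move: Wb'; rewrite -halfspaceC.
Qed.

(** Only the closing vertex w is asked for: without triangles, such a 4-cycle is automatically
    induced. *)
Definition square_at x u v :=
  [/\ adj x u, adj x v, u <> v & exists w, [/\ w <> x, adj w u & adj w v]].

(** Induction along the ladder. Edges are oriented, and the side x u of a square is compared with v
    w, directed the same way across the split. *)
Lemma square_opposite_constant (col : G -> G -> bool) a b a' b' :
  (forall x u v w, adj x u -> adj x v -> u <> v -> w <> x ->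
     adj w u -> adj w v -> col x u = col v w) ->
  adj a b -> adj a' b' -> halfspace a b a' -> halfspace b a b' ->
  col a b = col a' b'.
Proof.
move=> colP + a'b'; move En : (dist a a') => n.
elim: n a b En => [|n IHn] a b aa' ab Wa' Wb'.
  have E := dist0_eq Gc aa'; subst a'; congr col; apply: contrapT => bb'.
  have ba : adj b a by rewrite adj_sym.
  move: Wb' => /(halfspaceE _ ba).
  have := adj_dist Gc a'b'; have := dist_gt0 Gc bb'; dist_lia Gc.
have [|a1 [b1 [[aa1 bb1 a1b1] Wa1 Wb1 d1]]] := ladder ab a'b' Wa' Wb'.
  by move=> E; subst a'; rewrite distxx in aa'.
have ba : adj b a by rewrite adj_sym.
have b1b : adj b1 b by rewrite adj_sym.
have b1a1 : adj b1 a1 by rewrite adj_sym.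
have b1a : b1 <> a by move=> E; subst b1; apply: (halfspace_other ba).
have ba1 : b <> a1 by move=> E; subst a1; apply: (halfspace_other ab).
rewrite (colP a b a1 b1) //; apply: IHn => //; first by lia.
  by rewrite -(halfspace_eq ab a1b1).
by rewrite -(halfspace_eq ba b1a1).
Qed.

Lemma crossing_square A B :
  convex A -> convex (~` A) -> convex B -> convex (~` B) ->
  A `&` B !=set0 -> A `&` ~` B !=set0 ->
  ~` A `&` B !=set0 -> ~` A `&` ~` B !=set0 ->
  exists x u v w, [/\ [/\ adj x u, adj x v, adj w u & adj w v],
    A x /\ ~ A u, A v /\ ~ A w, B x /\ B u & ~ B v /\ ~ B w].
Proof.
move=> cA cnA cB cnB [p [Ap Bp]] [q [Aq nBq]] [r [nAr Br]] [s [nAs nBs]].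
have [a [b [ab Aa nAb Ia Ib]]] := crossing_edge Gc Ap nAr.
have [a' [b' [a'b' Aa' nAb' Ia' Ib']]] := crossing_edge Gc Aq nAs.
have Ba : B a := cB _ _ Bp Br _ Ia; have Bb : B b := cB _ _ Bp Br _ Ib.
have nBa' : ~ B a' := cnB _ _ nBq nBs _ Ia'.
have nBb' : ~ B b' := cnB _ _ nBq nBs _ Ib'.
clear p q r s Ap Bp Aq nBq nAr Br nAs nBs Ia Ib Ia' Ib'.
move En : (dist a a') => n; elim: n a b En ab Aa nAb Ba Bb => [|n IHn] a b En.
  by move=> _ _ _ Ba _; case: nBa'; rewrite -(dist0_eq Gc En).
move=> ab Aa nAb Ba Bb; have ba : adj b a by rewrite adj_sym.
have AE := convex_halfspace ab cA cnA Aa nAb.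
have nAE : ~` A = halfspace b a by rewrite AE halfspaceC.
have [|||a1 [b1 [[aa1 bb1 a1b1] Wa1 Wb1 d1]]] := @ladder a b a' b' ab a'b'.
- by rewrite -AE.
- by rewrite -nAE.
- by move=> E; subst a'.
rewrite -AE in Wa1; rewrite -nAE in Wb1.
have AE1 := convex_halfspace a1b1 cA cnA Wa1 Wb1.
(* Both ends of a rung leave B together. A rung that crossed both splits would force A to be B or
   its complement, but b is in B and not in A, and a is in both. *)
case: (pselect (B a1)) => Ba1; case: (pselect (B b1)) => Bb1.
- by apply: (IHn a1 b1) => //; lia.
- by case: nAb; rewrite AE1 -(convex_halfspace a1b1 cB cnB Ba1 Bb1).
- have nBE : ~` B = A.
    by rewrite AE1; apply: convex_halfspace => //; rewrite setCK.
  by exfalso; have : (~` B) a; [rewrite nBE|apply].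
by exists a, b, a1, b1; split=> //; split=> //; rewrite adj_sym.
Qed.

End Median.

(** * Links *)

Lemma sval_injective (T : Type) (P : T -> Prop) : injective (@sval T P).
Proof.
by move=> [x px] [y py] /= xy; subst y; rewrite (Prop_irrelevance px py).
Qed.

Section TwoCells.
Variable G : sgraph.
Hypothesis Gtf : forall x y z : G, adj x y -> adj y z -> ~ adj x z.
Implicit Types x y z u v w : G.

Lemma edge_at (e : set G) x : is_edge e -> e x ->
  exists2 u, adj x u & e = [set x; u].
Proof.
move=> [y [z [yz ->]]] [->|->]; first by exists z.
by exists y; [rewrite adj_sym|rewrite setUC].
Qed.

Lemma edge_set_inj x u v : adj x u -> adj x v ->
  [set x; u] = [set x; v] -> u = v.
Proof.
move=> xu xv E; have : [set x; v] u by rewrite -E; right.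
by case=> // ux; rewrite ux adj_irrefl in xu.
Qed.

Lemma common_two_cellP x u v : adj x u -> adj x v -> u <> v ->
  common_two_cell [set x; u] [set x; v] <-> square_at x u v.
Proof.
move=> xu xv uv; split=> [[S [[f [[fi fa] ->]] xuS xvS]]|[_ _ _ [w [wx wu wv]]]].
  have [i _ ix] : range f x by apply: xuS; left.
  have [j _ ju] : range f u by apply: xuS; right.
  have [k _ kv] : range f v by apply: xvS; right.
  rewrite -ix -ju -kv in xu xv uv *; rewrite !fa in xu xv.
  have jk : j <> k by move=> E; apply: uv; rewrite E.
  suff [l [li lj lk]] : exists l : 'I_4, [/\ l <> i, @cycle_adj 4 l j & @cycle_adj 4 l k].
    split=> //; try by rewrite fa.
    by exists (f l); rewrite !fa; split=> // /fi.
  (* With x at position i, the vertices u and v occupy the two neighbouring positions, and i + 2 is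
     opposite x. *)
  have l4 : (i + 2) %% 4 < 4 by rewrite ltn_mod.
  exists (Ordinal l4); move: xu xv jk {uv xuS xvS fi fa ix ju kv}.
  case: i l4 => [[|[|[|[|//]]]] ?] l4; case: j => [[|[|[|[|//]]]] ?] //;
    case: k => [[|[|[|[|//]]]] ?] // _ _ jk; split=> //;
    by case: jk; apply: val_inj.
pose f (i : cycle_graph 4) : G := nth x [:: x; u; w; v] i.
have ux : adj u x by rewrite adj_sym.
have vx : adj v x by rewrite adj_sym.
have uw : adj u w by rewrite adj_sym.
have vw : adj v w by rewrite adj_sym.
have nuv := Gtf ux xv; have nvu := Gtf vx xu.
have nxw := Gtf xu uw; have nwx := Gtf wu ux.
exists (range f); split; last 2 first.
- by move=> y [->|->]; [exists (inord 0)|exists (inord 1)];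
    rewrite // /f inordK.
- by move=> y [->|->]; [exists (inord 0)|exists (inord 3)];
    rewrite // /f inordK.
exists f; split=> //; split.
  move=> i j; rewrite /f.
  have nxu : x <> u by move=> E; move: xu; rewrite E adj_irrefl.
  have nxv : x <> v by move=> E; move: xv; rewrite E adj_irrefl.
  have nwu : w <> u by move=> E; move: wu; rewrite E adj_irrefl.
  have nwv : w <> v by move=> E; move: wv; rewrite E adj_irrefl.
  case: i => [[|[|[|[|//]]]] ?]; case: j => [[|[|[|[|//]]]] ?] //= E;
    by [exact: val_inj|exfalso; move: E; apply: nesym|exfalso; move: E].
move=> i j; rewrite /f.
case: i => [[|[|[|[|//]]]] ?]; case: j => [[|[|[|[|//]]]] ?];
  by rewrite /= ?adj_irrefl //; apply/negP.
Qed.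

(** An edge at x is coded by its other endpoint, which keeps sets of vertices as edges out of the
    later arguments. *)
Lemma Link_bipartiteP x : bipartite (Link x) <->
  exists col : G -> bool, forall u v, square_at x u v -> col u != col v.
Proof.
split=> [[c cP]|[col colP]].
  pose col u := `[< exists e : Link x, sval e = [set x; u] /\ c e >].
  have colE (e : Link x) u : sval e = [set x; u] -> col u = c e.
    move=> eu; apply/asboolP/idP => [[e' [e'u ce']]|ce]; last by exists e.
    suff -> : e = e' by [].
    by apply: sval_injective; rewrite eu e'u.
  have mk u : adj x u -> exists e : Link x, sval e = [set x; u].
    move=> xu; have h : is_edge [set x; u] /\ [set x; u] x.
      by split; [exists x, u|left].
    by exists (exist _ [set x; u] h).
  exists col => u v sq; have [xu xv uv _] := sq.
  have [e eu] := mk u xu; have [e' e'v] := mk v xv.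
  rewrite (colE e) // (colE e') //; apply: cP; apply/asboolP.
  rewrite eu e'v; split; last exact/common_two_cellP.
  by move=> /(edge_set_inj xu xv).
pose c (e : Link x) := `[< exists u, [/\ adj x u, sval e = [set x; u] & col u] >].
have cE (e : Link x) u : adj x u -> sval e = [set x; u] -> c e = col u.
  move=> xu eu; apply/asboolP/idP => [[v [xv ev cv]]|cu]; last by exists u.
  by have -> : u = v by apply: (@edge_set_inj x) => //; rewrite -eu.
exists c => e e' /asboolP.
have [[ed ex] [ed' ex']] := (svalP e, svalP e').
have [u xu eu] := edge_at ed ex; have [v xv ev] := edge_at ed' ex'.
rewrite (cE _ u) // (cE _ v) // eu ev => -[ne] /common_two_cellP sq.
by apply: colP; apply: sq => // E; apply: ne; rewrite E.
Qed.

Lemma Link_complex_bipartiteP : bipartite (Link_complex G) <->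
  exists col : G -> G -> bool,
    (forall x u, adj x u -> col x u = col u x) /\
    (forall x u v, square_at x u v -> col x u != col x v).
Proof.
split=> [[c cP]|[col [colC colP]]].
  pose col x u := `[< exists e : Link_complex G, sval e = [set x; u] /\ c e >].
  have colE (e : Link_complex G) x u : sval e = [set x; u] -> col x u = c e.
    move=> eu; apply/asboolP/idP => [[e' [e'u ce']]|ce]; last by exists e.
    suff -> : e = e' by [].
    by apply: sval_injective; rewrite eu e'u.
  exists col; split=> [x u _|x u v sq].
    by congr asbool; apply: eq_exists => e; rewrite setUC.
  have [xu xv uv _] := sq.
  have eu : is_edge [set x; u] by exists x, u.
  have ev : is_edge [set x; v] by exists x, v.
  rewrite (colE (exist _ _ eu)) // (colE (exist _ _ ev)) //.
  apply: cP; apply/asboolP.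
  have hu : is_edge [set x; u] /\ [set x; u] x by split=> //; left.
  have hv : is_edge [set x; v] /\ [set x; v] x by split=> //; left.
  pose P e := is_edge e /\ e x.
  exists x, (exist P _ hu), (exist P _ hv); split=> //; apply/asboolP => /=.
  split; last exact/common_two_cellP.
  by move=> /(edge_set_inj xu xv).
pose c (e : Link_complex G) :=
  `[< exists x u, [/\ adj x u, sval e = [set x; u] & col x u] >].
have cE (e : Link_complex G) x u : adj x u -> sval e = [set x; u] -> c e = col x u.
  move=> xu eu; apply/asboolP/idP => [[y [v [yv ev cv]]]|cu]; last by exists x, u.
  have : [set x; u] y by rewrite -eu ev; left.
  have : [set x; u] v by rewrite -eu ev; right.
  move=> [vE|vE] [yE|yE]; rewrite {}vE {}yE in yv cv.
  - by rewrite adj_irrefl in yv.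
  - by rewrite colC.
  - by [].
  - by rewrite adj_irrefl in yv.
exists c => e e' /asboolP[x [a [b [ae be /asboolP[ne two]]]]].
have [[ed ex] [ed' ex']] := (svalP a, svalP b).
have [u xu eu] := edge_at ed ex; have [v xv ev] := edge_at ed' ex'.
rewrite (cE e x u) -?ae // (cE e' x v) -?be //; apply: colP.
by apply/common_two_cellP; rewrite -?eu -?ev // => E; apply: ne; rewrite eu ev E.
Qed.

End TwoCells.

(** * Odd cycles, cocycles and cogwheels *)

Section OddCycle.
Variables (T : Type) (R : T -> T -> Prop).
Hypothesis R_sym : forall x y, R x y -> R y x.

Definition chain (x y : T) (n : nat) : Prop :=
  exists p : nat -> T, [/\ p 0 = x, p n = y & forall i, i < n -> R (p i) (p i.+1)].

Lemma chain_rcons x y z n : chain x y n -> R y z -> chain x z n.+1.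
Proof.
move=> [p [p0 pn pR]] yz; exists (fun i => if i <= n then p i else z).
rewrite ltnn; split=> // i; rewrite ltnS => i_n; rewrite i_n.
by case: ltnP => [/pR //|ni]; have -> : i = n by [lia]; rewrite pn.
Qed.

Lemma chain_cat x y z m n : chain x y m -> chain y z n -> chain x z (m + n).
Proof.
move=> xy; elim: n z => [|n IHn] z [p [p0 pn pR]].
  by rewrite addn0 -pn p0.
rewrite addnS -pn; apply: chain_rcons (pR n _) => //; apply: IHn.
by exists p; split=> // i i_n; apply: pR; lia.
Qed.

Lemma chain_sym x y n : chain x y n -> chain y x n.
Proof.
move=> [p [p0 pn pR]]; exists (fun i => p (n - i)); rewrite subn0 subnn.
split=> // i i_n; apply: R_sym; have -> : n - i = (n - i.+1).+1 by lia.
by apply: pR; lia.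
Qed.

Lemma two_coloring_of_even_cycles :
  (forall x n, chain x x n -> ~~ odd n) ->
  exists c : T -> bool, forall x y, R x y -> c x != c y.
Proof.
move=> even.
pose comp x : set T := [set y | exists n, chain y x n].
(* The representative depends only on the component as a set, so related points share it; the colour
   is the parity of a chain from it. The option type avoids a default element of T. *)
pose pick (A : set T) : option T :=
  if pselect (A !=set0) is left e then Some (projT1 (cid e)) else None.
pose c x := `[< exists r n, [/\ pick (comp x) = Some r, ~~ odd n & chain r x n] >].
have pickP x : exists2 r, pick (comp x) = Some r & exists n, chain r x n.
  rewrite /pick; case: pselect => [e|[]]; last first.
    by exists x, 0; exists (fun=> x).
  by exists (projT1 (cid e)) => //; case: cid.
have compE x y : R x y -> comp x = comp y.
  move=> xy; apply/seteqP; split=> z [n zn]; exists n.+1.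
    exact: chain_rcons zn xy.
  exact: chain_rcons zn (R_sym xy).
exists c => x y xy; have [r rx [n rn]] := pickP x.
have ryn := chain_rcons rn xy.
have ry : pick (comp y) = Some r by rewrite -(compE _ _ xy).
apply/eqP => cxy; case: (boolP (c x)) => [cx|ncx].
  have := cx; rewrite cxy => /asboolP[r1 [n1 [+ n1e r1y]]].
  rewrite ry => -[E]; subst r1.
  case/asboolP: cx => r2 [n2 [+ n2e r2x]]; rewrite rx => -[E]; subst r2.
  have := even _ _ (chain_cat (chain_rcons r2x xy) (chain_sym r1y)).
  by rewrite oddD /= (negbTE n1e) (negbTE n2e).
case: (boolP (odd n)) => on.
  have : c y by apply/asboolP; exists r, n.+1; rewrite /= on.
  by rewrite -cxy (negbTE ncx).
by case/negP: ncx; apply/asboolP; exists r, n.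
Qed.

(* A shortest odd closed walk has no repeated vertex. *)
Lemma two_coloring_or_odd_cycle :
  (exists c : T -> bool, forall x y, R x y -> c x != c y) \/
  (exists n p, [/\ odd n, p n = p 0, forall i, i < n -> R (p i) (p i.+1)
                & forall i j, i < j < n -> p i <> p j]).
Proof.
case: (pselect (exists n, `[< odd n /\ exists x, chain x x n >])) => [ex|nex].
  right; case: (ex_minnP ex) => n /asboolP[on [x [p [p0 pn pR]]]] nmin.
  exists n, p; split=> // [|i j /andP[ij jn] pij]; first by rewrite p0.
  (* A repetition cuts the closed walk into two shorter closed walks whose lengths add up to n, so
     one of them is odd. *)
  have c1 : chain (p i) (p i) (j - i).
    exists (fun k => p (i + k)); rewrite addn0 subnKC ?(ltnW ij) //; split=> // k kj.
    by rewrite addnS; apply: pR; lia.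
  have c2 : chain x x (i + (n - j)).
    apply: (@chain_cat _ (p i)).
      by exists p; split=> // k ki; apply: pR; lia.
    exists (fun k => p (j + k)); rewrite addn0 pij subnKC ?(ltnW jn) //.
    by split=> // k kn; rewrite addnS; apply: pR; lia.
  have short m y : chain y y m -> m < n -> ~~ odd m.
    move=> ym mn; apply/negP => om; have : n <= m; last by rewrite leqNgt mn.
    by apply/nmin/asboolP; split=> //; exists y.
  have odd1 : ~~ odd (j - i) by apply: short c1 _; lia.
  have odd2 : ~~ odd (i + (n - j)) by apply: short c2 _; lia.
  have : odd ((j - i) + (i + (n - j))) by rewrite (_ : _ + _ = n) //; lia.
  by rewrite oddD (negbTE odd1) (negbTE odd2).
left; apply: two_coloring_of_even_cycles => x n xn; apply/negP => on.
by apply: nex; exists n; apply/asboolP; split=> //; exists x.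
Qed.

End OddCycle.

Section Cocycle.
Variables (G : sgraph) (Gmed : median_graph G).

Let Gc : connected_graph G := Gmed.1.
Let Gm : modular G. Proof. by have /median_graphP[] := Gmed. Qed.

(* The potential is summed up along geodesics to a base vertex; independence
   of the geodesic follows from the quadrangle condition. *)
Lemma square_cocycle_coboundary (t : G -> G -> bool) :
  (forall x y, t x y = t y x) ->
  (forall x u v w, adj x u -> adj x v -> u <> v -> w <> x ->
     adj w u -> adj w v -> (t x u (+) t u w) (+) (t w v (+) t v x) = false) ->
  exists s : G -> bool, forall x y, adj x y -> s x (+) s y = t x y.
Proof.
move=> tC tsq; case: (pselect (exists b : G, True)) => [[b _]|nG]; last first.
  by exists (fun=> false) => x; case: nG; exists x.
have /choice[dn dnP] : forall x, exists y,
    x <> b -> adj x y /\ dist b x = (dist b y).+1.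
  move=> x; case: (pselect (x = b)) => [->|xb]; first by exists b.
  have [y xy d] := dist_step Gc xb; exists y => _; split=> //; dist_lia Gc.
pose s_ := fix s_ n x := if n is n'.+1 then s_ n' (dn x) (+) t x (dn x) else false.
pose s x := s_ (dist b x) x.
have main n x y : dist b x = n.+1 -> dist b y = n -> adj x y -> s x (+) s y = t x y.
  elim: n x y => [|n IHn] x y xn yn xy.
    have yb := dist0_eq Gc yn.
    have xb : x <> b by move=> E; rewrite E distxx in xn.
    have [xd dxd] := dnP x xb; have dxb : dn x = b.
      by apply/esym/(dist0_eq Gc); lia.
    by rewrite /s xn yn /= dxb -yb addbF.
  have xb : x <> b by move=> E; rewrite E distxx in xn.
  have [xd dxd] := dnP x xb.
  have sx : s x = s (dn x) (+) t x (dn x).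
    by rewrite /s dxd.
  case: (pselect (y = dn x)) => [->|ydn]; first by rewrite sx addbC addbA addbb.
  (* Both y and [dn x] are one step nearer to b than x, so they close to a square with a vertex w
     nearer still. The sum of [t] around it vanishes, and induction covers its two lower sides. *)
  have [||w [wy wd dw]] := @quadrangle _ Gc Gm b x y (dn x) xy xd ydn; [by lia..|].
  have yw : adj y w by rewrite adj_sym.
  have dw' : adj (dn x) w by rewrite adj_sym.
  have wx : w <> x by move=> E; subst w; lia.
  have dn1 : dist b (dn x) = n.+1 by lia.
  have dw1 : dist b w = n by lia.
  have e1 : s y (+) s w = t y w by apply: IHn.
  have e2 : s (dn x) (+) s w = t (dn x) w by apply: IHn.
  have := tsq x y (dn x) w xy xd ydn wx wy wd.
  rewrite sx -e1 (tC w) -e2 (tC (dn x) x).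
  by case: (s y) (s w) (s (dn x)) (t x y) (t x (dn x)) => [] [] [] [] [].
exists s => x y xy; have := adj_parity Gc Gm b xy => -[E|E].
  exact: main E erefl xy.
by rewrite addbC tC; apply: main E erefl _; rewrite adj_sym.
Qed.

End Cocycle.

Section Cogwheel.
Variable n : nat.

(* The hub, the neighbours of the hub, and the corners of the squares around
   the hub. *)
Inductive cog_vertex := Hub | Spoke of 'I_n | Rim of 'I_n.

Definition cog_adj (x y : cog_vertex) : bool :=
  match x, y with
  | Hub, Spoke _ | Spoke _, Hub => true
  | Spoke j, Rim i | Rim i, Spoke j => (j == i) || (j == ordS i)
  | _, _ => false
  end.

Lemma cog_adj_sym : symmetric cog_adj.
Proof. by move=> [|i|i] [|j|j]. Qed.

Lemma cog_adj_irrefl : irreflexive cog_adj.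
Proof. by case. Qed.

Definition cog := SGraph cog_adj_sym cog_adj_irrefl.

Hypothesis n_gt2 : 2 < n.

Lemma ordS_neq (i : 'I_n) : ordS i <> i.
Proof.
move=> /(congr1 val) /=; have := ltn_ord i.
case: (i.+1 =P n) => [ni|ni] i_n; first by rewrite ni modnn; lia.
by rewrite modn_small; lia.
Qed.

Lemma ordSS_neq (i : 'I_n) : ordS (ordS i) <> i.
Proof.
move=> /(congr1 val) /=; have := ltn_ord i.
case: (i.+1 =P n) => [ni|ni] i_n; first by rewrite ni modnn modn_small; lia.
rewrite (@modn_small i.+1); last by lia.
case: (i.+2 =P n) => [ni2|ni2]; first by rewrite ni2 modnn; lia.
by rewrite modn_small; lia.
Qed.

Lemma iter_ordS (i : 'I_n) k : iter k (@ordS n) i = (i + k) %% n :> nat.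
Proof.
elim: k => [|k IHk] /=; first by rewrite addn0 modn_small.
by rewrite IHk -[in LHS]addn1 modnDml addn1 addnS.
Qed.

Lemma cog_connected : connected_graph cog.
Proof.
suff H x : exists k, walk (Hub : cog) x k.
  move=> x y; have [[k xk] [m ym]] := (H x, H y).
  by exists (k + m); apply: walk_cat (walk_sym xk) ym.
case: x => [|i|i]; first by exists 0; apply: walk0.
  by exists 1; apply: walk1.
exists 2; apply: (@walkS _ _ (Spoke i : cog)) => //; apply: walk1.
by rewrite /= eqxx.
Qed.

Section Embedding.
Variables (G : sgraph) (Gmed : median_graph G) (x : G) (A : 'I_n -> G).
Hypotheses (A_inj : injective A) (A_sq : forall i, square_at x (A i) (A (ordS i))).

Let Gc : connected_graph G := Gmed.1.
Let Gm : modular G. Proof. by have /median_graphP[] := Gmed. Qed.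

(** A rim vertex is at distance 2 from x and shares with it only its own two spokes, since K_{2,3}
    is excluded. Parity then leaves one value for each remaining distance: 3 from a spoke to a rim
    vertex, 2 or 4 between rim vertices. *)
Lemma isometric_cog : isometric_subgraph cog G.
Proof.
have /choice[S SP] : forall i, exists w,
    [/\ w <> x, adj w (A i) & adj w (A (ordS i))].
  by move=> i; have [_ _ _ [w []]] := A_sq i; exists w.
have xA i : adj x (A i) by have [] := A_sq i.
have Ax i : adj (A i) x by rewrite adj_sym.
have AS i : A i <> A (ordS i) by have [] := A_sq i.
have dxS i : dist x (S i) = 2.
  have [Sx SA _] := SP i; apply: (common_neighbor_dist Gc Gm (Ax i)).
    by rewrite adj_sym.
  exact: nesym.
(* Otherwise x and S i have three common neighbours. *)
have near i g : adj x g -> adj (S i) g -> g = A i \/ g = A (ordS i).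
  move=> xg Sg; have [Sx SA SAS] := SP i.
  case: (pselect (g = A i)) => [|gA]; first by left.
  case: (pselect (g = A (ordS i))) => [|gAS]; first by right.
  case: (@median_K23_free _ Gmed x (S i) (A i) (A (ordS i)) g) => //;
    exact: nesym.
have SA i j : adj (S i) (A j) -> (j == i) || (j == ordS i).
  by move=> /(near _ _ (xA j)) [/A_inj ->|/A_inj ->]; rewrite eqxx ?orbT.
have S_inj : injective S.
  move=> i j Sij; have [_ SAj SASj] := SP j; rewrite -Sij in SAj SASj.
  case/orP: (SA _ _ SAj) => [/eqP //|/eqP ji].
  case/orP: (SA _ _ SASj) => [/eqP|/eqP /ordS_inj //].
  by rewrite ji => /ordSS_neq.
pose f (c : cog) : G :=
  match c with Hub => x | Spoke i => A i | Rim i => S i end.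
have AdjS i j : (j == i) || (j == ordS i) -> adj (S i) (A j).
  by have [_ ? ?] := SP i; case/orP => /eqP ->.
have fhom : {homo f : c c' / adj c c'}.
  by move=> [|i|i] [|j|j] //= ij; [rewrite adj_sym|]; apply: AdjS.
exists f; apply: isometric_embeddingP => // c c'.
have adjw d d' : cog_adj d d' -> walk (d : cog) d' (dist (f d) (f d')).
  by move=> dd'; rewrite (adj_dist Gc (fhom d d' dd')); apply: walk1.
have wHR i : walk (Hub : cog) (Rim i) 2.
  apply: (@walkS _ _ (Spoke i : cog)) => //; apply: walk1.
  by rewrite /= eqxx.
have wSR i j : walk (Spoke j : cog) (Rim i) (dist (A j) (S i)).
  case: (boolP ((j == i) || (j == ordS i))) => ij; first exact: adjw.
  rewrite (dist3 Gc Gm (Ax j) (dxS i)); first exact: walkS (wHR i).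
  by rewrite adj_sym => /SA; rewrite (negbTE ij).
have wRR i j : walk (Rim i : cog) (Rim j) (dist (S i) (S j)).
  case: (i =P j) => [->|ij]; first by rewrite distxx; apply: walk0.
  have Sij : S i <> S j by move=> /S_inj.
  have [_ SAi SASi] := SP i; have [_ SAj SASj] := SP j.
  have two k : (k == i) || (k == ordS i) -> (k == j) || (k == ordS j) ->
      walk (Rim i : cog) (Rim j) (dist (S i) (S j)).
    move=> ki kj; rewrite (@common_neighbor_dist _ Gc Gm (A k)) //.
    - by apply: (@walkS _ _ (Spoke k : cog)) => //; apply: walk1.
    - by rewrite adj_sym; apply: AdjS.
    - by rewrite adj_sym; apply: AdjS.
  case: (pselect (exists2 k, (k == i) || (k == ordS i) & (k == j) || (k == ordS j))).
    by move=> [k]; apply: two.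
  move=> ndis; have noh h : adj x h -> adj (S i) h -> adj (S j) h -> False.
    move=> xh Sih Sjh; apply: ndis.
    by have [hE|hE] := near _ _ xh Sih; subst h; eexists; apply: SA; eassumption.
  (* A midpoint adjacent to x would be a spoke of both rim vertices. A midpoint at distance 3 from x
     is replaced, by the quadrangle condition, with one adjacent to x. *)
  have d2 : dist (S i) (S j) <> 2.
    move=> d2; have [h [hi hj]] := @dist_split _ Gc (S i) (S j) 1 1 d2.
    have Sih := dist1_adj Gc hi; have hSj := dist1_adj Gc hj.
    have hSi : adj h (S i) by rewrite adj_sym.
    have Sjh : adj (S j) h by rewrite adj_sym.
    case: (adj_parity Gc Gm x Sih) => xh; rewrite dxS in xh.
      by apply: (noh h) => //; apply: (dist1_adj Gc); lia.
    have [||s [sSi sSj xs]] := @quadrangle _ Gc Gm x h (S i) (S j) hSi hSj Sij;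
      rewrite ?dxS //.
    rewrite dxS in xs; apply: (noh s); [|by rewrite adj_sym..].
    by apply: (dist1_adj Gc); lia.
  (* The distance is even by parity, positive, different from 2, and at most 4 by the route through
     x. *)
  have -> : dist (S i) (S j) = 4.
    have [q [q1 q2]] := @dist_split _ Gc (S i) x 1 1 (etrans (distC Gc _ _) (dxS i)).
    have [r [r1 r2]] := @dist_split _ Gc x (S j) 1 1 (dxS j).
    have Sq := dist1_adj Gc q1; have qx := dist1_adj Gc q2.
    have p1 := adj_parity Gc Gm (S j) Sq; have p2 := adj_parity Gc Gm (S j) qx.
    have := dist_gt0 Gc Sij; have := dxS i; have := dxS j.
    by have := dist_triangle Gc x (S i) (S j); dist_lia Gc.
  by apply: (walk_cat (walk_sym (wHR i)) (wHR j)).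
case: c c' => [|i|i] [|j|j]; try by apply: adjw.
- by rewrite distxx; apply: walk0.
- by rewrite /= dxS.
- case: (i =P j) => [->|ij]; first by rewrite distxx; apply: walk0.
  rewrite (@common_neighbor_dist _ Gc Gm x) //=; last by move=> /A_inj.
  by apply: (@walkS _ _ (Hub : cog)) => //; apply: walk1.
- exact: wSR.
- by rewrite /= distC // dxS; apply: walk_sym.
- by rewrite /= distC //; apply: walk_sym.
- exact: wRR.
Qed.

End Embedding.

(** Consecutive spokes span a square with the hub, so their colours alternate around a closed cycle
    of odd length. *)
Lemma cog_odd_link (G : sgraph) (f : cog -> G) (col : G -> bool) : odd n ->
  injective f -> {homo f : c c' / adj c c'} ->
  (forall u v, square_at (f Hub) u v -> col u != col v) -> False.
Proof.
move=> on fi fhom colP; have n0 : 0 < n by lia.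
pose a k := f (Spoke (iter k (@ordS n) (Ordinal n0))).
have colS k : col (a k) = col (a 0) (+) odd k.
  elim: k => [|k IHk]; first by rewrite addbF.
  have : col (a k) != col (a k.+1); last first.
    by rewrite IHk /=; case: (col (a 0)) (odd k) (col (a k.+1)) => [] [] [].
  set i := iter k (@ordS n) (Ordinal n0).
  apply: colP; split; try exact: fhom.
    by move=> /fi [] /= /esym /ordS_neq.
  exists (f (Rim i)); split; first by move=> /fi.
    by apply: fhom; rewrite /= eqxx.
  by apply: fhom; rewrite /= eqxx orbT.
have : a n = a 0.
  congr (f (Spoke _)); apply: val_inj => /=.
  by rewrite iter_ordS add0n modnn.
by move=> /(congr1 col); rewrite colS on; case: (col _).
Qed.

End Cogwheel.

(** * Cogwheels as simplex graphs of cycles and as cubes without a vertex *)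

Lemma differ_by_oneP (T : Type) (A B : set T) : differ_by_one A B <->
  exists z, (A z <-> ~ B z) /\ forall t, t <> z -> (A t <-> B t).
Proof.
split=> [[z AB]|[z [zAB AB]]]; exists z.
  have inY t : (A `+` B) t <-> t = z by rewrite AB.
  have := (inY z).2 erefl; rewrite /setY /setU /setD /= => ABz.
  split; first by tauto.
  move=> t tz; have := (inY t).1; rewrite /setY /setU /setD /=.
  case: (pselect (A t)); case: (pselect (B t)); tauto.
apply/seteqP; split=> t; rewrite /setY /setU /setD /=.
  move=> ABt; apply: contrapT => tz; have := AB t tz; tauto.
by move=> ->; case: (pselect (A z)); case: (pselect (B z)); tauto.
Qed.

Lemma bool_neqP (a b : bool) : a <> b <-> (a <-> ~ b).
Proof. by case: a; case: b; split=> [ne|[h1 h2]] //; intuition. Qed.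

Lemma isometric_of_isomorphism (G H : sgraph) (f : G -> H) :
  connected_graph G -> {mono f : x y / adj x y} -> (forall y, exists x, f x = y) ->
  isometric_subgraph H G.
Proof.
move=> Gc fa /choice[g gK]; exists g; apply: isometric_embeddingP => // x y.
  by move=> xy; rewrite -fa !gK.
rewrite -{1}(gK x) -{1}(gK y); apply: walk_hom; last exact: dist_walk.
by move=> u v; rewrite fa.
Qed.

Section CogSets.
Variable n : nat.
Hypothesis n_gt2 : 2 < n.

(** The clique of C_n named by a vertex of the cogwheel. For n = 3 these are all subsets of the
    index set except the full one. *)
Definition cogset (c : cog n) : pred 'I_n := fun t =>
  match c with
  | Hub => false
  | Spoke i => t == i
  | Rim i => (t == i) || (t == ordS i)
  end.

Let ordS_eq (i : 'I_n) : (ordS i == i) = false.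
Proof. by apply/eqP; apply: ordS_neq. Qed.

Let ordS_eq' (i : 'I_n) : (i == ordS i) = false.
Proof. by rewrite eq_sym ordS_eq. Qed.

Let ordSS_eq (i j : 'I_n) : j == ordS i -> (i == ordS j) = false.
Proof. by move=> /eqP ->; apply/eqP => /esym; apply: ordSS_neq. Qed.

Lemma cogset_inj c c' : cogset c =1 cogset c' -> c = c'.
Proof.
case: c c' => [|i|i] [|j|j] //= E.
- by have := E j; rewrite /= eqxx.
- by have := E j; rewrite /= eqxx.
- by have := E i; rewrite /= eqxx.
- by have := E i; rewrite /= eqxx => /esym/eqP ->.
- have := E j; have := E (ordS j).
  rewrite /= !eqxx orbT /= => /eqP SjE /eqP jE.
  by have := @ordS_neq _ n_gt2 j; rewrite SjE jE.
- by have := E i; rewrite /= eqxx.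
- have := E i; have := E (ordS i).
  rewrite /= !eqxx orbT /= => /esym/eqP SiE /esym/eqP iE.
  by have := @ordS_neq _ n_gt2 i; rewrite SiE iE.
have := E i; have := E (ordS i); rewrite /= !eqxx orbT /=.
move=> /esym/orP[/eqP Sij|/eqP/ordS_inj -> //] /esym/orP[/eqP -> //|/eqP iE].
by case: (@ordSS_neq _ n_gt2 j); rewrite -iE.
Qed.

Lemma cogset_adj (c c' : cog n) : adj c c' <->
  exists z, cogset c z <> cogset c' z /\
            forall t, t <> z -> cogset c t = cogset c' t.
Proof.
split=> [|[z [zP tP]]].
  have rim (i j : 'I_n) : (j == i) || (j == ordS i) -> exists z,
      (z == j) <> (z == i) || (z == ordS i) /\
      forall t, t <> z -> (t == j) = (t == i) || (t == ordS i).
    case/orP => /eqP ->; [exists (ordS i)|exists i].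
      rewrite ordS_eq eqxx orbT; split=> // t /eqP/negbTE ->.
      by rewrite orbF.
    by rewrite ordS_eq' eqxx; split=> // t /eqP/negbTE ->.
  case: c c' => [|i|i] [|j|j] //= ij.
  - by exists j; rewrite eqxx; split=> // t /eqP/negbTE ->.
  - by exists i; rewrite eqxx; split=> // t /eqP/negbTE ->.
  - exact: rim.
  - by have [z [zE tE]] := rim _ _ ij; exists z; split=> [/esym|t /tE].
have diff t : cogset c t <> cogset c' t -> t = z.
  by move=> ne; apply: contrapT => /tP.
have two t t' : t <> t' -> cogset c t <> cogset c' t ->
    cogset c t' <> cogset c' t' -> False.
  by move=> tt' /diff tz /diff tz'; apply: tt'; rewrite tz tz'.
have rim i j : (forall t, t <> z -> (t == j) = (t == i) || (t == ordS i)) ->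
    (j == i) || (j == ordS i).
  move=> E; apply: contrapT => /negP; rewrite negb_or => /andP[ji jSi].
  have iz : i = z.
    by apply: contrapT => /E; rewrite eqxx eq_sym (negbTE ji).
  have Siz : ordS i = z.
    by apply: contrapT => /E; rewrite eqxx orbT eq_sym (negbTE jSi).
  by have := @ordS_neq _ n_gt2 i; rewrite Siz iz.
case: c c' zP tP diff two => [|i|i] [|j|j] //= zP tP diff two.
- case: (two j (ordS j)); rewrite ?eqxx ?orbT //.
  by apply/nesym/ordS_neq.
- case: (i =P j) => [ij|ij]; first by rewrite ij in zP.
  case: (two i j ij); rewrite !eqxx; first by move: ij => /eqP/negbTE ->.
  by rewrite eq_sym; move: ij => /eqP/negbTE ->.
- exact: rim.
- case: (two i (ordS i)); rewrite ?eqxx ?orbT //.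
  by apply/nesym/ordS_neq.
- by apply: rim => t /tP.
case: (i =P j) => [ij|/eqP/negbTE ij]; first by rewrite ij in zP.
have ji : (j == i) = false by rewrite eq_sym.
have Sij : (ordS i == ordS j) = false by rewrite (inj_eq (@ordS_inj n)).
have Sji : (ordS j == ordS i) = false by rewrite (inj_eq (@ordS_inj n)).
case: (boolP (i == ordS j)) => iSj.
  have jSi := ordSS_eq iSj.
  case: (two (ordS i) j).
  - by apply/eqP; rewrite eq_sym jSi.
  - by rewrite ordS_eq eqxx Sij orbF eq_sym jSi.
  - by rewrite ji jSi eqxx.
case: (boolP (j == ordS i)) => jSi.
  case: (two (ordS j) i).
  - by apply/eqP; rewrite eq_sym (negbTE iSj).
  - by rewrite ordS_eq eqxx Sji orbT eq_sym (negbTE iSj).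
  - by rewrite ij (negbTE iSj) eqxx.
case: (two i j).
- by apply/eqP; rewrite ij.
- by rewrite ij (negbTE iSj) eqxx.
- by rewrite ji (negbTE jSi) eqxx.
Qed.

End CogSets.

(** For n > 3 a clique of C_n has at most two elements: a third would be adjacent to both ends of an
    edge. For n = 3 the whole triangle would be missed. *)
Lemma cog_simplex_graph n : 3 < n ->
  exists f : cog n -> simplex_graph (cycle_graph n),
    [/\ injective f, {mono f : c c' / adj c c'} & forall K, exists c, f c = K].
Proof.
move=> n_gt3; have n_gt2 : 2 < n by lia.
have cl (c : cog n) : clique (cogset c : set (cycle_graph n)).
  have ordSP (i : 'I_n) : @adj (cycle_graph n) i (ordS i).
    by rewrite /= /cycle_adj eqxx (eq_sym i) andbT; apply/eqP/ordS_neq.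
  have ordSP' (i : 'I_n) : @adj (cycle_graph n) (ordS i) i.
    by rewrite adj_sym.
  case: c => [|i|i] x y //=; first by move=> /eqP -> /eqP ->.
  by move=> /orP[]/eqP -> /orP[]/eqP -> //= _; [apply: ordSP|apply: ordSP'].
pose f (c : cog n) : simplex_graph (cycle_graph n) := exist _ _ (cl c).
have fE c c' : f c = f c' -> c = c'.
  move=> /(congr1 sval) /= E; apply: cogset_inj => // t.
  by have := congr1 (fun A : set _ => A t) E; apply: is_true_inj.
exists f; split=> // [c c'|[K cK]].
  apply/asboolP/idP => [/differ_by_oneP[z [zP tP]]|/(cogset_adj n_gt2)[z [zP tP]]].
    apply/(cogset_adj n_gt2); exists z; split; first exact/bool_neqP.
    by move=> t /tP /= E; apply/idP/idP; tauto.
  apply/differ_by_oneP; exists z; split; last by move=> t /tP /= ->.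
  exact/bool_neqP.
suff [c cE] : exists c : cog n, K = cogset c.
  by exists c; apply: sval_injective; rewrite /= cE.
have Kadj (i j : 'I_n) : K i -> K j -> i <> j ->
    i.+1 = j \/ j.+1 = i \/ (i = 0 :> nat /\ j.+1 = n) \/ (j = 0 :> nat /\ i.+1 = n).
  by move=> Ki Kj ij; apply/(cycle_adjP n_gt2); apply: cK.
have ordSE (i j : 'I_n) : i.+1 = j \/ (j = 0 :> nat /\ i.+1 = n) -> j = ordS i.
  move=> h; apply: val_inj => /=; have := ltn_ord j.
  by case: h => [<- jn|[-> ->] _]; rewrite ?modnn // modn_small.
case: (pselect (K !=set0)) => [[i Ki]|K0]; last first.
  by exists (Hub n); apply/seteqP; split=> t //= Kt; case: K0; exists t.
case: (pselect (exists2 j, K j & j <> i)) => [[j Kj ji]|Ki1]; last first.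
  exists (Spoke i); apply/seteqP; split=> t /= => [Kt|/eqP -> //].
  by apply: contrapT => ti; apply: Ki1; exists t => // tE; apply: ti; rewrite tE.
have [k [Kk KSk]] : exists k, K k /\ K (ordS k).
  have /= := Kadj i j Ki Kj (nesym ji); have := ordSE i j; have := ordSE j i.
  move=> h1 h2 h; have [h'|h'] : j = ordS i \/ i = ordS j by intuition.
    by exists i; rewrite -h'.
  by exists j; rewrite -h'.
exists (Rim k); apply/seteqP; split=> t /= => [Kt|/orP[]/eqP -> //].
apply: contrapT => /negP; rewrite negb_or => /andP[/eqP tk /eqP tSk].
have h1 := Kadj _ _ Kt Kk tk; have h2 := Kadj _ _ Kt KSk tSk.
have h3 := Kadj _ _ Kk KSk (nesym (@ordS_neq _ n_gt2 k)).
have h4 : t.+1 = k \/ (k = 0 :> nat /\ t.+1 = n).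
  by have := ordSE k t; intuition.
have h5 : t <> ordS k :> nat by move=> /val_inj.
have := ltn_ord t; have := ltn_ord k; have := ltn_ord (ordS k).
have h6 : t <> k :> nat by move=> /val_inj.
move: (ordS k : nat) h2 h3 h5 => s; lia.
Qed.

Lemma cog_Q3_minus (v : hypercube 'I_3) :
  exists f : cog 3 -> Q3_minus v,
    [/\ injective f, {mono f : c c' / adj c c'} & forall u, exists c, f c = u].
Proof.
pose V : set 'I_3 := sval v.
(* The complement of the symmetric difference of V and [cogset c]. The omitted vertex V would
   require the full index set, the one subset that is not a cogset. *)
pose A (c : cog 3) : set 'I_3 := [set t | V t <-> cogset c t].
pose g (c : cog 3) : hypercube 'I_3 := exist _ (A c) finite_finset.
have notV c : g c <> v.
  move=> /(congr1 sval) /= E; have AV t : cogset c t.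
    have : V t <-> (V t <-> cogset c t) by rewrite {1}/V -E.
    by case: (cogset c t) => //; have F : ~ is_true false by []; tauto.
  case: c {E} AV => [|i|i] AV.
  - by have := AV ord0.
  - by have := AV (ordS i); rewrite /= => /eqP/ordS_neq; apply.
  - have := AV (ordS (ordS i)); rewrite /= => /orP[/eqP|/eqP /ordS_inj].
      by apply: ordSS_neq.
    by apply: ordS_neq.
pose f (c : cog 3) : Q3_minus v := exist _ (g c) (notV c).
have AE c c' t : (A c t <-> A c' t) <-> cogset c t = cogset c' t.
  rewrite /A /=; split=> [h|-> //].
  by apply/idP/idP; case: (pselect (V t)); case: (pselect (cogset c t));
    case: (pselect (cogset c' t)); tauto.
exists f; split=> [c c' /(congr1 sval)/(congr1 sval) /= E|c c'|[[B Bf] nB]].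
- by apply: cogset_inj => // t; apply/AE; rewrite E.
- apply/asboolP/idP => [/differ_by_oneP[z [zP tP]]|/(@cogset_adj 3 isT)[z [zP tP]]].
    apply/(@cogset_adj 3 isT); exists z; split.
      by move=> /AE; move: zP; rewrite /= /A /=; tauto.
    by move=> t /tP /AE.
  apply/differ_by_oneP; exists z; split; last by move=> t /tP /AE.
  have : ~ (A c z <-> A c' z) by move=> /AE.
  move=> nAA; suff : A c z <-> ~ A c' z by [].
  by case: (pselect (A c z)); case: (pselect (A c' z)); tauto.
pose e t := `[< B t <-> V t >].
suff [c cE] : exists c : cog 3, cogset c =1 e.
  exists c; apply/sval_injective/sval_injective/seteqP => /=.
  split=> t /=; rewrite /A /= cE /e asboolE; case: (pselect (B t)); tauto.
(* As B differs from V, the set coded by [e] misses some t; its values at the other two indices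
   leave four possibilities, each of them a cogset. *)
have [t te] : exists t, e t = false.
  apply: contrapT => all_e; apply: nB => /=; apply/sval_injective/seteqP => /=.
  have E t : B t <-> V t.
    by apply/asboolP; apply/negPn/negP => et; apply: all_e; exists t; apply/negbTE.
  by split=> t /E.
have i3 (i : 'I_3) : i = t \/ i = ordS t \/ i = ordS (ordS t).
  case: i t {te} => [[|[|[|//]]] i3] [[|[|[|//]]] t3];
    by [left; apply: val_inj|right; left; apply: val_inj|right; right; apply: val_inj].
have n1 := @ordS_neq 3 isT t; have n2 := @ordSS_neq 3 isT t.
have n3 := @ordS_neq 3 isT (ordS t).
have tS : (t == ordS t) = false by apply/eqP/nesym.
have tSS : (t == ordS (ordS t)) = false by apply/eqP/nesym.
have SSS : (ordS t == ordS (ordS t)) = false by apply/eqP/nesym.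
have St : (ordS t == t) = false by apply/eqP.
have SSt : (ordS (ordS t) == t) = false by apply/eqP.
have SSSt : (ordS (ordS t) == ordS t) = false by apply/eqP.
have cE (c : cog 3) : cogset c t = false -> cogset c (ordS t) = e (ordS t) ->
    cogset c (ordS (ordS t)) = e (ordS (ordS t)) -> cogset c =1 e.
  by move=> c0 c1 c2 i; case: (i3 i) => [->|[->|->]] //; rewrite te.
case e1 : (e (ordS t)); case e2 : (e (ordS (ordS t))).
- by exists (Rim (ordS t)); apply: cE; rewrite /= ?e1 ?e2 ?eqxx ?tS ?tSS ?orbT.
- by exists (Spoke (ordS t)); apply: cE; rewrite /= ?e1 ?e2 ?eqxx ?tS ?SSSt.
- by exists (Spoke (ordS (ordS t))); apply: cE; rewrite /= ?e1 ?e2 ?eqxx ?tSS ?SSS.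
- by exists (Hub 3); apply: cE; rewrite /= ?e1 ?e2.
Qed.

(** * Incompatible splits and links *)

Definition convex_half (G : sgraph) (A : set G) : Prop := convex A /\ convex (~` A).

Definition crossing (T : Type) (A B : set T) : Prop :=
  [/\ A `&` B !=set0, A `&` ~` B !=set0, ~` A `&` B !=set0 & ~` A `&` ~` B !=set0].

Lemma convex_splitP (G : sgraph) (P : set (set G)) : convex_split P <->
  exists A, [/\ P = [set A; ~` A], convex_half A, A !=set0 & ~` A !=set0].
Proof.
split=> [[A [B [-> [A0 B0] AB0 ABT [cA cB]]]]|[A [-> [cA cnA] A0 nA0]]].
  have BE : B = ~` A.
    apply/seteqP; split=> x.
      by move=> Bx Ax; have : (A `&` B) x by []; rewrite AB0.
    by move=> nAx; have : (A `|` B) x by [rewrite ABT]; case.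
  by exists A; subst B.
exists A, (~` A); split=> //; first by rewrite setICr.
by rewrite setUCr.
Qed.

(** A colouring of splits becomes a colouring of halves that is invariant under complement, so that
    a split can be named by any [halfspace a b]. *)
Lemma Inc_bipartiteP (G : sgraph) : bipartite (Inc G) <->
  exists k : set G -> bool, (forall A, k (~` A) = k A) /\
    forall A B, convex_half A -> convex_half B -> crossing A B -> k A != k B.
Proof.
split=> [[c cP]|[k [kC kP]]].
  exists (fun A => `[< exists P : Inc G, sval P = [set A; ~` A] /\ c P >]).
  split=> [A|A B hA hB cAB].
    by congr asbool; apply: eq_exists => P; rewrite setCK setUC.
  have [[x [Ax Bx]] [y [Ay nBy]] [z [nAz Bz]] [t [nAt nBt]]] := cAB.
  have PA : convex_split [set A; ~` A].
    by apply/convex_splitP; exists A; split=> //; [exists x|exists z].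
  have PB : convex_split [set B; ~` B].
    by apply/convex_splitP; exists B; split=> //; [exists x|exists y].
  have kE C (PC : convex_split [set C; ~` C]) :
      `[< exists P : Inc G, sval P = [set C; ~` C] /\ c P >] = c (exist _ _ PC).
    apply/asboolP/idP => [[P [PE]]|cC]; last by exists (exist _ _ PC).
    by have -> : P = exist _ _ PC by apply: sval_injective.
  rewrite (kE A PA) (kE B PB); apply: cP; apply/asboolP => A' B' /=.
  by move=> [->|->] [->|->]; [exists x|exists y|exists z|exists t].
have /choice[h hP] : forall P : Inc G,
    exists A, [/\ sval P = [set A; ~` A], convex_half A, A !=set0 & ~` A !=set0].
  by move=> P; apply/convex_splitP; apply: svalP.
exists (fun P => k (h P)) => P Q /asboolP PQ.
have [PE hA _ _] := hP P; have [QE hB _ _] := hP Q.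
by apply: kP => //; split; apply: PQ; rewrite ?PE ?QE; by [left|right].
Qed.

Section IncLink.
Variables (G : sgraph) (Gmed : median_graph G).

Let Gc : connected_graph G := Gmed.1.
Let Gm : modular G. Proof. by have /median_graphP[] := Gmed. Qed.
Let Gtf := triangle_free Gc Gm.

Lemma halfspace_half (a b : G) : adj a b -> convex_half (halfspace a b).
Proof.
move=> ab; split; first exact: halfspace_convex.
by rewrite halfspaceC //; apply: halfspace_convex; rewrite // adj_sym.
Qed.

Lemma half_halfspace (A : set G) : convex_half A -> A !=set0 -> ~` A !=set0 ->
  exists a b, adj a b /\ A = halfspace a b.
Proof.
move=> [cA cnA] [x Ax] [y nAy].
have [a [b [ab Aa nAb _ _]]] := crossing_edge Gc Ax nAy.
by exists a, b; split=> //; apply: convex_halfspace.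
Qed.

Lemma square_crossing (x u v : G) : square_at x u v ->
  crossing (halfspace x u) (halfspace x v).
Proof.
move=> [xu xv uv [w [wx wu wv]]].
have ux : adj u x by rewrite adj_sym.
have vx : adj v x by rewrite adj_sym.
have uw : adj u w by rewrite adj_sym.
have uv2 := common_neighbor_dist Gc Gm xu xv uv.
have wx2 := common_neighbor_dist Gc Gm uw ux wx.
have wu1 := adj_dist Gc wu; have wv1 := adj_dist Gc wv.
have ux1 := adj_dist Gc ux; have vx1 := adj_dist Gc vx.
split; rewrite ?halfspaceC //; [exists x|exists v|exists u|exists w]; split;
  rewrite /halfspace /= ?distxx; dist_lia Gc.
Qed.

Lemma Inc_Link_complex : bipartite (Inc G) -> bipartite (Link_complex G).
Proof.
move=> /Inc_bipartiteP[k [kC kP]]; apply/Link_complex_bipartiteP => //.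
exists (fun x u => k (halfspace x u)); split=> [x u xu|x u v sq].
  by rewrite -(halfspaceC Gmed xu) kC.
have [xu xv _ _] := sq; apply: kP; try exact: halfspace_half.
exact: square_crossing.
Qed.

Lemma Link_complex_Inc : bipartite (Link_complex G) -> bipartite (Inc G).
Proof.
move=> /(Link_complex_bipartiteP Gtf)[col [colC colP]]; apply/Inc_bipartiteP.
(* Opposite sides both differ in colour from the side x v between them, and there are only two
   colours. *)
have colsq x u v w : adj x u -> adj x v -> u <> v -> w <> x ->
    adj w u -> adj w v -> col x u = col v w.
  move=> xu xv uv wx wu wv.
  have sqx : col x u != col x v by apply: colP; split=> //; exists w.
  have vx : adj v x by rewrite adj_sym.
  have ux : adj u x by rewrite adj_sym.
  have vw : adj v w by rewrite adj_sym.
  have uw : adj u w by rewrite adj_sym.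
  have sqv : col v x != col v w.
    by apply: colP; split=> //; [exact: nesym|exists u; split=> //; exact: nesym].
  move: sqx sqv; rewrite (colC v x) //.
  by case: (col x u) (col x v) (col v w) => [] [] [].
pose k (A : set G) := `[< exists a b, [/\ adj a b, A = halfspace a b & col a b] >].
(* The colour of a half can be read off any edge that leaves it. *)
have kE (A : set G) x u : adj x u -> convex_half A -> A x -> ~ A u -> k A = col x u.
  move=> xu [cA cnA] Ax nAu; have AE := convex_halfspace Gmed xu cA cnA Ax nAu.
  apply/asboolP/idP => [[a [b [ab AE' cab]]]|cxu]; last by exists x, u.
  rewrite -(@square_opposite_constant _ Gmed col a b) //; first by rewrite -AE'.
  by rewrite -halfspaceC // -AE'.
exists k; split=> [A|A B hA hB [q1 q2 q3 q4]].
  congr asbool; apply/propext; split=> -[a [b [ab AE cab]]]; exists b, a;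
    rewrite -colC // adj_sym ab; split=> //.
    by rewrite -[A]setCK AE halfspaceC.
  by rewrite AE halfspaceC.
have [[cA cnA] [cB cnB]] := (hA, hB).
have [x [u [v [w [[xu xv wu wv] [Ax nAu] [Av nAw] [Bx Bu] [nBv nBw]]]]]] :=
  crossing_square Gmed cA cnA cB cnB q1 q2 q3 q4.
rewrite (kE A x u) // (kE B x v) //; apply: colP; split=> //.
  by move=> E; apply: nBv; rewrite -E.
by exists w; split=> // E; apply: nAw; rewrite E.
Qed.

Lemma Link_complex_Link (x : G) : bipartite (Link_complex G) -> bipartite (Link x).
Proof.
move=> /(Link_complex_bipartiteP Gtf)[col [_ colP]].
by apply/(Link_bipartiteP Gtf); exists (col x) => u v; apply: colP.
Qed.

Lemma Link_Link_complex :
  (forall x : G, bipartite (Link x)) -> bipartite (Link_complex G).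
Proof.
move=> bip; apply/(Link_complex_bipartiteP Gtf).
have /choice[col colP] : forall x, exists col : G -> bool,
    forall u v, square_at x u v -> col u != col v.
  by move=> x; apply/(Link_bipartiteP Gtf).
(* The disagreement of the two link colourings on an edge. Regrouped by corners, its sum around a
   square consists of four terms, each equal to [true] because a link colouring separates the two
   sides at its corner. *)
pose t x y := col x y (+) col y x.
have [||s sP] := @square_cocycle_coboundary _ Gmed t.
- by move=> x y; rewrite /t addbC.
- move=> x u v w xu xv uv wx wu wv.
  have vx : adj v x by rewrite adj_sym.
  have ux : adj u x by rewrite adj_sym.
  have vw : adj v w by rewrite adj_sym.
  have uw : adj u w by rewrite adj_sym.
  have e1 : col x u != col x v by apply: colP; split=> //; exists w.
  have e2 : col w u != col w v.
    by apply: colP; split=> //; exists x; split=> //; exact: nesym.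
  have e3 : col u x != col u w.
    apply: colP; split=> //; first exact: nesym.
    by exists v; split=> //; exact: nesym.
  have e4 : col v x != col v w.
    by apply: colP; split=> //; [exact: nesym|exists u].
  rewrite /t; move: e1 e2 e3 e4.
  case: (col x u); case: (col x v) => // _; case: (col w u); case: (col w v) => // _;
  case: (col u x); case: (col u w) => // _; case: (col v x); case: (col v w) => //.
exists (fun x u => col x u (+) s x); split=> [x u xu|x u v /colP].
  have := sP x u xu; rewrite /t.
  by case: (s x) (s u) (col x u) (col u x) => [] [] [] [].
by case: (col x u) (col x v) (s x) => [] [] [].
Qed.

(* An odd cycle in a link spans an isometric cogwheel. *)
Lemma Link_bipartite_of_no_cog (x : G) :
  (forall n, odd n -> 2 < n -> ~ isometric_subgraph (cog n) G) ->
  bipartite (Link x).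
Proof.
move=> nocog; apply/(Link_bipartiteP Gtf).
have [||[n [p [on pn pR pinj]]]] := @two_coloring_or_odd_cycle G (square_at x).
- move=> u v [xu xv uv [w [wx wu wv]]]; split=> //; first exact: nesym.
  by exists w.
- by [].
have n2 : 2 < n.
  case: n on pn pR {pinj} => [|[|[|n]]] // _ p1 /(_ 0 isT)[_ _].
  by rewrite p1.
case: (nocog n on n2).
apply: (@isometric_cog n n2 _ Gmed x (fun i => p i)) => [i j pij|i].
  apply: val_inj; case: (ltngtP i j) => // ij.
    by case: (pinj i j) => //; rewrite ij ltn_ord.
  by case: (pinj j i) => //; rewrite ij ltn_ord.
have := pR i (ltn_ord i); congr square_at => /=.
case: (i.+1 =P n) => [->|ni]; first by rewrite modnn pn.
have i_n := ltn_ord i; by rewrite modn_small //; lia.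
Qed.

End IncLink.

(** * Hypercubes *)

Section EvenCycle.
Variables (G : sgraph) (Gmed : median_graph G).

(* Three consecutive edges define pairwise incompatible splits. *)
Lemma Inc_bipartite_no_even_cycle k : bipartite (Inc G) -> 2 <= k ->
  ~ isometric_subgraph (cycle_graph (2 * k + 2)) G.
Proof.
move=> /Inc_bipartiteP[col [_ colP]] k2 [f [[fi fa] fd]].
have n2 : 2 < 2 * k + 2 by lia.
have lt0 : 0 < 2 * k + 2 by lia. have lt1 : 1 < 2 * k + 2 by lia.
have lt3 : 3 < 2 * k + 2 by lia. have lt4 : k + 2 < 2 * k + 2 by lia.
have lt5 : k + 3 < 2 * k + 2 by lia.
pose p i (lt : i < 2 * k + 2) : G := f (Ordinal lt).
have pd i j (li : i < _) (lj : j < _) : dist (p i li) (p j lj) = cycle_dist (2 * k + 2) i j.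
  by rewrite /p fd (dist_cycle n2).
have pa i (li : i < _) (li1 : i.+1 < _) : adj (p i li) (p i.+1 li1).
  by rewrite /p fa; apply/(cycle_adjP n2); left.
have a01 := pa 0 lt0 lt1; have a12 := pa 1 lt1 n2; have a23 := pa 2 n2 lt3.
have h01 := halfspace_half Gmed a01; have h12 := halfspace_half Gmed a12.
have h23 := halfspace_half Gmed a23.
(* The half near i of the edge from i to i + 1 meets the cycle in the k + 1 vertices ending in i. So
   the halves near 0 and 1 begin at k + 2 and k + 3, the antipodes of 1 and 2. *)
have c1 : crossing (halfspace (p 0 lt0) (p 1 lt1)) (halfspace (p 1 lt1) (p 2 n2)).
  split; rewrite ?halfspaceC //;
    [exists (p 0 lt0)|exists (p _ lt4)|exists (p 1 lt1)|exists (p 2 n2)];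
    by split; rewrite /halfspace /= !pd /cycle_dist; lia.
have c2 : crossing (halfspace (p 1 lt1) (p 2 n2)) (halfspace (p 2 n2) (p 3 lt3)).
  split; rewrite ?halfspaceC //;
    [exists (p 1 lt1)|exists (p _ lt5)|exists (p 2 n2)|exists (p 3 lt3)];
    by split; rewrite /halfspace /= !pd /cycle_dist; lia.
(* Here k >= 2 enters: for k = 1 the two edges would be opposite sides of a 4-cycle and cross the
   same split. *)
have c3 : crossing (halfspace (p 0 lt0) (p 1 lt1)) (halfspace (p 2 n2) (p 3 lt3)).
  split; rewrite ?halfspaceC //;
    [exists (p 0 lt0)|exists (p _ lt4)|exists (p 1 lt1)|exists (p 3 lt3)];
    by split; rewrite /halfspace /= !pd /cycle_dist; lia.
have := colP _ _ h01 h12 c1; have := colP _ _ h12 h23 c2; have := colP _ _ h01 h23 c3.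
by case: (col _) (col _) (col _) => [] [] [].
Qed.

End EvenCycle.

Section FiniteSets.
Variable X : Type.
Implicit Types A B C : set X.

(** The type [{classic X}] supplies the choice structure that finite sets need over an arbitrary X.
    The value is meaningful for finite sets only. *)
Definition ncard A : nat := #|` fset_set (A : set {classic X})|.

Lemma ncard0 : ncard set0 = 0.
Proof. by rewrite /ncard; have -> := @fset_set0 {classic X}; rewrite cardfs0. Qed.

Lemma ncard_setU1 A z : finite_set A -> ~ A z -> ncard (z |` A) = (ncard A).+1.
Proof.
move=> Af nAz; rewrite /ncard fset_setU1 // cardfsU1 in_fset_set //.
by rewrite memNset.
Qed.

Lemma differ_by_one_setU1 A B : differ_by_one A B ->
  exists z, (~ A z /\ B = z |` A) \/ (~ B z /\ A = z |` B).
Proof.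
move=> /differ_by_oneP[z [zP tP]]; exists z.
have split2 (C D : set X) : ~ C z -> D z -> (forall t, t <> z -> (C t <-> D t)) ->
    D = z |` C.
  move=> nCz Dz CD; apply/seteqP; split=> t => [Dt|[->//|Ct]].
    by case: (pselect (t = z)) => tz; [left|right; apply/(CD t tz)].
  by case: (pselect (t = z)) => tz; [rewrite tz|apply/(CD t tz)].
case: (pselect (A z)) => Az; [right|left]; split; try tauto.
  by apply: split2 => //; [tauto|move=> t /tP; tauto].
by apply: split2 => //; apply: contrapT; tauto.
Qed.

Lemma finite_differ_by_one A B : finite_set A -> differ_by_one A B -> finite_set B.
Proof.
move=> Af /differ_by_one_setU1[z [[_ ->]|[_ AE]]].
  by rewrite finite_setU; split=> //; apply: finite_set1.
by apply: sub_finite_set Af; rewrite AE => t; right.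
Qed.

Lemma ncard_differ_by_one A B : finite_set A -> finite_set B -> differ_by_one A B ->
  ncard A = (ncard B).+1 \/ ncard B = (ncard A).+1.
Proof.
move=> Af Bf /differ_by_one_setU1[z [[nAz ->]|[nBz ->]]]; [right|left];
  exact: ncard_setU1.
Qed.

Lemma finite_setY A B : finite_set A -> finite_set B -> finite_set (A `+` B).
Proof. by move=> Af Bf; rewrite finite_setU; split; apply: finite_setD. Qed.

Lemma differ_by_one_setY A B C : differ_by_one A B -> differ_by_one (A `+` C) (B `+` C).
Proof.
move=> /differ_by_oneP[z [zP tP]]; apply/differ_by_oneP; exists z.
rewrite /setY /setU /setD /=; split.
  by case: (pselect (A z)); case: (pselect (B z)); case: (pselect (C z)); tauto.
by move=> t /tP; tauto.
Qed.

End FiniteSets.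

Section Hypercube.
Variable X : Type.
Notation Q := (hypercube X).

Lemma hypercube_bipartite (A B : Q) : adj A B ->
  odd (ncard (sval A)) != odd (ncard (sval B)).
Proof.
move=> /asboolP AB; have [Af Bf] := (svalP A, svalP B).
by case: (ncard_differ_by_one Af Bf AB) => -> /=; case: odd.
Qed.

Lemma walk_hypercube_ncard (A B : Q) n : walk A B n -> ncard (sval A `+` sval B) <= n.
Proof.
move=> /(@walk_lipschitz Q (fun C => ncard (sval C `+` sval B))).
rewrite setYK ncard0 add0n; apply=> C D /asboolP CD.
have [Bf Cf Df] := And3 (svalP B) (svalP C) (svalP D).
have := ncard_differ_by_one (finite_setY Cf Bf) (finite_setY Df Bf)
  (differ_by_one_setY (sval B) CD).
lia.
Qed.

Lemma hypercube_connected : connected_graph Q.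
Proof.
have fin0 := @finite_set0 X.
suff H n (A : Q) : ncard (sval A) = n -> exists m, walk A (exist _ set0 fin0 : Q) m.
  move=> A B; have [[m Am] [k Bk]] := (H _ A erefl, H _ B erefl).
  by exists (m + k); apply: walk_cat Am (walk_sym Bk).
elim: n A => [|n IHn] [A Af] /= An.
  exists 0; suff -> : exist _ A Af = exist _ set0 fin0 :> Q by apply: walk0.
  apply: sval_injective => /=; apply/seteqP; split=> // t At.
  move: An => /cardfs0_eq A0.
  by have : (t : {classic X}) \in fset_set (A : set {classic X});
    [rewrite in_fset_set // inE|rewrite A0].
have [z Az] : A !=set0.
  apply/set0P/eqP => A0; by move: An; rewrite A0 ncard0.
have Bf : finite_set (A `\ z) by apply: finite_setD.
have AE : A = z |` (A `\ z).
  by rewrite setD1K.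
have nBz : ~ (A `\ z) z by move=> [_]; apply.
have [|m Bm] := IHn (exist _ (A `\ z) Bf).
  by move: An; rewrite [in LHS]AE ncard_setU1 //= => -[].
exists m.+1; apply: walkS Bm; apply/asboolP/differ_by_oneP; exists z => /=.
by split=> // t tz; rewrite /setD /=; tauto.
Qed.

Lemma hypercube_K23_free (m s p q r : Q) : m <> s -> p <> q -> p <> r -> q <> r ->
  adj m p -> adj m q -> adj m r -> adj s p -> adj s q -> adj s r -> False.
Proof.
move=> ms pq pr qr mp mq mr sp sq sr.
(* Each common neighbour differs from m in a point where m and s differ, and
   there are exactly two such points. *)
have key (u : Q) : adj m u -> adj s u -> exists i j,
    [/\ sval m i <-> ~ sval u i, forall t, t <> i -> (sval m t <-> sval u t),
        i <> j & forall t, (sval m t <-> ~ sval s t) <-> (t = i \/ t = j)].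
  move=> /asboolP/differ_by_oneP[i [iP tP]] /asboolP/differ_by_oneP[j [jP sP]].
  have ij : i <> j.
    move=> E; subst j; apply: ms; apply: sval_injective; apply/seteqP.
    have E t : sval m t <-> sval s t.
      case: (pselect (t = i)) => [->|ti]; last by have := tP t ti; have := sP t ti; tauto.
      by case: (pselect (sval m i)); case: (pselect (sval s i)); tauto.
    by split=> t /E.
  exists i, j; split=> // t.
  case: (pselect (t = i)) => [->|ti].
    by have := sP i ij; split=> [_|_]; [left|tauto].
  case: (pselect (t = j)) => [->|tj].
    by have := tP j (nesym ij); split=> [_|_]; [right|case: (pselect (sval u j)); tauto].
  have := tP t ti; have := sP t tj.
  by case: (pselect (sval m t)); case: (pselect (sval s t)); tauto.
have [i [i' [iP iQ ii' iR]]] := key p mp sp.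
have [j [j' [jP jQ jj' jR]]] := key q mq sq.
have [l [l' [lP lQ ll' lR]]] := key r mr sr.
have inj (u v : Q) a : (sval m a <-> ~ sval u a) -> (sval m a <-> ~ sval v a) ->
    (forall t, t <> a -> (sval m t <-> sval u t)) ->
    (forall t, t <> a -> (sval m t <-> sval v t)) -> u = v.
  move=> ua va ut vt; apply: sval_injective; apply/seteqP.
  have E t : sval u t <-> sval v t.
    case: (pselect (t = a)) => [->|ta]; last by have := ut t ta; have := vt t ta; tauto.
    by case: (pselect (sval u a)); case: (pselect (sval v a)); tauto.
  by split=> t /E.
have ij : i <> j by move=> E; subst j; apply: pq; apply: (inj p q i).
have il : i <> l by move=> E; subst l; apply: pr; apply: (inj p r i).
have jl : j <> l by move=> E; subst l; apply: qr; apply: (inj q r j).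
have j2 : j = i'.
  have : j = i \/ j = i' by apply/iR/jR; left.
  by case=> // ji; case: ij.
have l2 : l = i'.
  have : l = i \/ l = i' by apply/iR/lR; left.
  by case=> // li; case: il.
by apply: jl; rewrite j2 l2.
Qed.

End Hypercube.

Lemma alternating_even (c : nat -> bool) n :
  (forall i, i < n -> c i != c i.+1) -> c n = c 0 -> ~~ odd n.
Proof.
move=> cS cn; have : c n = c 0 (+) odd n.
  elim: n cS {cn} => [|n IHn] cS; first by rewrite addbF.
  have := cS n (ltnSn n); rewrite IHn => [|i i_n]; last by apply: cS; lia.
  by rewrite /=; case: (c 0) (odd n) (c n.+1) => [] [] [].
by rewrite cn; case: (c 0) (odd n) => [] [].
Qed.

Lemma cycle_sequence n (G : sgraph) (f : cycle_graph n -> G) : 2 < n ->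
  {homo f : i j / adj i j} ->
  exists p : nat -> G, [/\ p n = p 0, forall i, adj (p i) (p i.+1)
    & injective f -> forall i j, i < j < n -> p i <> p j].
Proof.
move=> n2 fhom; have n0 : 0 < n by lia.
pose o k := iter k (@ordS n) (Ordinal n0); exists (fun k => f (o k)).
split=> [|i|fi i j ij /fi /(congr1 val)] /=.
- by congr f; apply: val_inj; rewrite /= iter_ordS add0n modnn.
- apply: fhom => /=; rewrite /cycle_adj eqxx andbT.
  by apply/eqP/nesym/ordS_neq.
by rewrite !iter_ordS !add0n !modn_small; lia.
Qed.

Section HypercubeSubgraph.
Variables (G : sgraph) (X : Type) (GX : isometric_subgraph G (hypercube X)).

Lemma hypercube_no_odd_cycle n : 2 < n -> odd n -> ~ isometric_subgraph (cycle_graph n) G.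
Proof.
move=> n2 on nG; have [f [[fi fa] _]] := isometric_subgraph_trans nG GX.
have fhom : {homo f : i j / adj i j} by move=> i j; rewrite fa.
have [p [pn pa _]] := cycle_sequence n2 fhom.
have := @alternating_even (fun i => odd (ncard (sval (p i)))) n.
by rewrite pn on => H; have := H (fun i _ => hypercube_bipartite (pa i)) erefl.
Qed.

Lemma hypercube_no_K23 : ~ isometric_subgraph (complete_bipartite 2 3) G.
Proof.
move=> KG; have [f [[fi fa] _]] := isometric_subgraph_trans KG GX.
pose L (i : 'I_2) : complete_bipartite 2 3 := inl i.
pose R (i : 'I_3) : complete_bipartite 2 3 := inr i.
apply: (@hypercube_K23_free _ (f (L ord0)) (f (L (inord 1)))
  (f (R ord0)) (f (R (inord 1))) (f (R (inord 2)))); rewrite ?fa //.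
all: by move=> /fi [] /(congr1 val) /=; rewrite ?inordK.
Qed.

End HypercubeSubgraph.

(** * Isometric embedding of median graphs into hypercubes *)

Section HalfspaceEmbedding.
Variables (G : sgraph) (Gmed : median_graph G) (b : G).

Let Gc : connected_graph G := Gmed.1.

(** The coordinates of x: each split is represented by its half away from the base vertex b. *)
Definition halves_at (x : G) : set (set G) :=
  [set H | convex_half H /\ ~ H b /\ H x].

(** An edge crosses a single split, and avoiding b selects one of its two halves. *)
Lemma separating_half (x y : G) : adj x y -> exists H,
  [/\ convex_half H, ~ H b, H x <-> ~ H y, H = halfspace x y \/ H = halfspace y x
    & forall K, convex_half K -> ~ K b -> K <> H -> (K x <-> K y)].
Proof.
move=> xy; have yx : adj y x by rewrite adj_sym.
have [h1 h2] := (halfspace_self Gmed xy, halfspace_other xy).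
have [h3 h4] := (halfspace_self Gmed yx, halfspace_other yx).
have uniq (K : set G) : convex_half K -> ~ (K x <-> K y) ->
    K = halfspace x y \/ K = halfspace y x.
  move=> [cK cnK] Kxy; case: (pselect (K x)) => Kx; [left|right].
    by apply: convex_halfspace => // Ky; apply: Kxy.
  by apply: convex_halfspace => //; apply: contrapT; tauto.
case: (pselect (halfspace x y b)) => bx.
  have nyb : ~ halfspace y x b by rewrite -halfspaceC //; apply.
  exists (halfspace y x); split=> //; first exact: halfspace_half.
  - by right.
  - move=> K hK nKb KH; apply: contrapT => /(uniq K hK)[KE|//].
    by apply: nKb; rewrite KE.
exists (halfspace x y); split=> //; first exact: halfspace_half.
- by left.
move=> K hK nKb KH; apply: contrapT => /(uniq K hK)[//|KE].
by apply: nKb; rewrite KE -halfspaceC.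
Qed.

Lemma halves_at_adj x y : adj x y -> differ_by_one (halves_at x) (halves_at y).
Proof.
move=> xy; have [H [hH nHb Hxy _ HU]] := separating_half xy.
apply/differ_by_oneP; exists H; rewrite /halves_at /=; split.
  by tauto.
by move=> K KH; have := HU K; tauto.
Qed.

Lemma finite_halves_at x : finite_set (halves_at x).
Proof.
move En : (dist x b) => n; elim: n x En => [|n IHn] x xb.
  rewrite (dist0_eq Gc xb) (_ : halves_at b = set0) //.
  by apply/seteqP; split=> // H [_ [+ Hb]]; apply.
have [|y xy d] := @dist_step _ Gc x b.
  by move=> E; rewrite E distxx in xb.
apply: finite_differ_by_one (IHn y _) _; first by lia.
by apply: halves_at_adj; rewrite adj_sym.
Qed.

(** Each edge of a geodesic crosses a new split: the one crossed by the first edge x z has z and y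
    on the same side, so it does not contribute to the count for z and y. *)
Lemma ncard_halves_at x y : ncard (halves_at x `+` halves_at y) = dist x y.
Proof.
move En : (dist x y) => n; elim: n x En => [|n IHn] x xy.
  by rewrite (dist0_eq Gc xy) setYK ncard0.
have [|z xz d] := @dist_step _ Gc x y.
  by move=> E; rewrite E distxx in xy.
have zx : adj z x by rewrite adj_sym.
rewrite -(IHn z); last by lia.
have [H [hH nHb Hxz HE HU]] := separating_half xz.
have yz : halfspace z x y.
  by rewrite /halfspace /= ![dist y _](distC Gc); lia.
have Hzy : H z <-> H y.
  have := halfspace_self Gmed zx; have := halfspace_other xz.
  have : ~ halfspace x z y by rewrite -halfspaceC //; apply.
  by case: HE => ->; tauto.
rewrite -(@ncard_setU1 _ _ H); first last.
- by rewrite /setY /setU /setD /halves_at /=; tauto.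
- by apply: finite_setY; apply: finite_halves_at.
congr ncard; apply/seteqP; split=> K.
  case: (pselect (K = H)) => KH; first by left.
  move=> h; right; move: h; rewrite /setY /setU /setD /halves_at /=.
  by have := HU K; tauto.
case: (pselect (K = H)) => [-> _|KH].
  rewrite /setY /setU /setD /halves_at /=.
  by case: (pselect (H x)); case: (pselect (H z)); tauto.
case=> //; rewrite /setY /setU /setD /halves_at /=.
by have := HU K; tauto.
Qed.

Definition halves_embedding (x : G) : hypercube (set G) :=
  exist _ (halves_at x) (finite_halves_at x).

Lemma halves_embedding_isometric : isometric_embedding halves_embedding.
Proof.
have fhom : {homo halves_embedding : x y / adj x y}.
  by move=> x y /halves_at_adj xy; apply/asboolP.
apply: isometric_embeddingP => // [|x y]; first exact: hypercube_connected.
suff -> : dist (halves_embedding x) (halves_embedding y) = dist x y.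
  exact: dist_walk.
apply/eqP; rewrite eqn_leq; apply/andP; split.
  exact/dist_le/(walk_hom fhom)/(dist_walk Gc).
rewrite -ncard_halves_at.
apply: (@walk_hypercube_ncard _ (halves_embedding x) (halves_embedding y)).
exact/dist_walk/hypercube_connected.
Qed.

End HalfspaceEmbedding.

Lemma median_graph_hypercube (G : sgraph) : median_graph G ->
  exists X : Type, isometric_subgraph G (hypercube X).
Proof.
move=> Gmed; case: (pselect (exists b : G, True)) => [[b _]|nG].
  exists (set G), (halves_embedding Gmed b).
  exact: halves_embedding_isometric.
exists unit; have noG (x : G) : False by apply: nG; exists x.
by exists (fun x => False_rect _ (noG x)); split; [split|] => x; case: (noG x).
Qed.

(** * Products of trees *)

Section Products.
Variables G H : sgraph.
Hypotheses (Gc : connected_graph G) (Hc : connected_graph H).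
Notation P := (cartesian G H).

Lemma walk_cartesian (u v : P) :
  walk u v (dist u.1 v.1 + dist u.2 v.2).
Proof.
case: u v => [a c] [b d] /=; apply: (@walk_cat _ _ ((b, c) : P)).
  apply: (@walk_hom G P (fun x => (x, c))); last exact: dist_walk.
  by move=> x y xy; apply/asboolP; right.
apply: (@walk_hom H P (fun x => (b, x))); last exact: dist_walk.
by move=> x y xy; apply/asboolP; left.
Qed.

Lemma cartesian_connected : connected_graph P.
Proof. by move=> u v; eexists; apply: walk_cartesian. Qed.

Lemma dist_cartesian (u v : P) : dist u v = dist u.1 v.1 + dist u.2 v.2.
Proof.
apply/eqP; rewrite eqn_leq (dist_le (walk_cartesian u v)) /=.
have := @walk_lipschitz P (fun w => dist w.1 v.1 + dist w.2 v.2) u v.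
rewrite !distxx; apply; last exact: dist_walk cartesian_connected _ _.
move=> w w' /asboolP[[-> /(adj_distl Hc v.2)]|[/(adj_distl Gc v.1) + ->]].
  by rewrite ![dist v.2 _]distC //; lia.
by rewrite ![dist v.1 _]distC //; lia.
Qed.

(** A sum of two triangle inequalities is tight exactly when both are. *)
Lemma median3_cartesian (u v w m : P) : median3 u v w m <->
  median3 u.1 v.1 w.1 m.1 /\ median3 u.2 v.2 w.2 m.2.
Proof.
rewrite /median3 !dist_cartesian.
have t1 := dist_triangle Gc; have t2 := dist_triangle Hc.
split=> [[e1 e2 e3]|[[e1 e2 e3] [f1 f2 f3]]]; last by split; lia.
have := t1 m.1 u.1 v.1; have := t1 m.1 v.1 w.1; have := t1 m.1 w.1 u.1.
have := t2 m.2 u.2 v.2; have := t2 m.2 v.2 w.2; have := t2 m.2 w.2 u.2.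
by move=> {t1 t2} *; split; split; lia.
Qed.

Lemma cartesian_median : median_graph G -> median_graph H -> median_graph P.
Proof.
move=> /median_graphP[_ Gm Gu] /median_graphP[_ Hm Hu]; apply/median_graphP.
split=> [|u v w|u v w [m1 m2] [m1' m2']]; first exact: cartesian_connected.
  have [m1 m1P] := Gm u.1 v.1 w.1; have [m2 m2P] := Hm u.2 v.2 w.2.
  by exists (m1, m2); apply/median3_cartesian.
move=> /median3_cartesian[/= h1 h2] /median3_cartesian[/= h3 h4].
by rewrite (Gu _ _ _ _ _ h1 h3) (Hu _ _ _ _ _ h2 h4).
Qed.

End Products.

Section Trees.
Variables (T : sgraph) (Ttree : tree T).

Lemma tree_square_free (x u v w : T) : adj x u -> adj x v -> u <> v -> w <> x ->
  adj w u -> adj w v -> False.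
Proof.
move=> xu xv uv wx wu wv; apply: (Ttree.2 4 isT).
exists (fun i : cycle_graph 4 => nth x [:: x; u; w; v] i).
have nxu := adj_neq xu; have nxv := adj_neq xv.
have nwu := adj_neq wu; have nwv := adj_neq wv; split.
  case=> [[|[|[|[|//]]]] ?] [[|[|[|[|//]]]] ?] //= E;
    by [exact: val_inj|exfalso; move: E; apply: nesym|exfalso; move: E].
case=> [[|[|[|[|//]]]] ?] [[|[|[|[|//]]]] ?] //= _;
  by rewrite // adj_sym.
Qed.

Lemma tree_median : median_graph T.
Proof.
have nocyc n : 2 < n -> ~ isometric_subgraph (cycle_graph n) T.
  move=> n2 [f [[fi fa] _]]; apply: (Ttree.2 n n2); exists f; split=> // i j.
  by rewrite fa.
apply: median_graph_of_no_cycle; first by case: Ttree.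
- exact: nocyc.
- move=> [f [[fi fa] _]].
  pose L (i : 'I_2) : complete_bipartite 2 3 := inl i.
  pose R (i : 'I_3) : complete_bipartite 2 3 := inr i.
  apply: (@tree_square_free (f (L ord0)) (f (R ord0)) (f (R (inord 1)))
    (f (L (inord 1)))); rewrite ?fa //.
    by move=> /fi [] /(congr1 val) /=; rewrite inordK.
  by move=> /fi [] /(congr1 val) /=; rewrite inordK.
- by move=> k k2; apply: nocyc; lia.
Qed.

(** Crossing halves would produce a 4-cycle. *)
Lemma tree_no_crossing (A B : set T) : convex_half A -> convex_half B -> ~ crossing A B.
Proof.
move=> [cA cnA] [cB cnB] [q1 q2 q3 q4].
have [x [u [v [w [[xu xv wu wv] [Ax nAu] [Av nAw] [Bx Bu] [nBv nBw]]]]]] :=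
  crossing_square tree_median cA cnA cB cnB q1 q2 q3 q4.
apply: (tree_square_free xu xv _ _ wu wv).
  by move=> E; apply: nBv; rewrite -E.
by move=> E; apply: nAw; rewrite E.
Qed.

End Trees.

Section DoubleTreeIncompatibility.
Variables (G T1 T2 : sgraph) (T1t : tree T1) (T2t : tree T2).
Variables (f : G -> cartesian T1 T2) (f_iso : isometric_embedding f).
Hypothesis Gmed : median_graph G.

(** If an edge moves in one factor only, distances to its two ends share the summand of the other
    factor, so its halfspace is the preimage of a halfspace of one tree. Splits of equal colour come
    from the same tree, where nothing crosses. *)
Lemma double_tree_Inc_bipartite : bipartite (Inc G).
Proof.
have [T1c _] := T1t; have [T2c _] := T2t.
have [m1 m2] := (tree_median T1t, tree_median T2t).
have fadj a b : adj a b -> ((f a).1 = (f b).1 /\ adj (f a).2 (f b).2) \/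
    (adj (f a).1 (f b).1 /\ (f a).2 = (f b).2).
  by rewrite -f_iso.1.2 => /asboolP.
have fdist a b : dist a b = dist (f a).1 (f b).1 + dist (f a).2 (f b).2.
  by rewrite -dist_cartesian // f_iso.2.
(* The factor in which an edge moves is the colour of the split it crosses. *)
pose k (A : set G) :=
  `[< exists a b, [/\ adj a b, A = halfspace a b & (f a).1 = (f b).1] >].
have kT (A : set G) : k A -> exists2 B : set T2, convex_half B & A = (snd \o f) @^-1` B.
  move=> /asboolP[a [b [ab -> fab]]].
  have [[_ fab2]|[fab1 _]] := fadj a b ab; last first.
    by rewrite fab adj_irrefl in fab1.
  exists (halfspace (f a).2 (f b).2); first exact: halfspace_half.
  by apply/seteqP; split=> x; rewrite /halfspace /= !fdist fab ltn_add2l.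
have kF (A : set G) : ~~ k A -> convex_half A -> A !=set0 -> ~` A !=set0 ->
    exists2 B : set T1, convex_half B & A = (fst \o f) @^-1` B.
  move=> /asboolPn nk hA A0 nA0; have [a [b [ab AE]]] := half_halfspace Gmed hA A0 nA0.
  have [[fab1 _]|[fab1 fab2]] := fadj a b ab; first by case: nk; exists a, b.
  exists (halfspace (f a).1 (f b).1); first exact: halfspace_half.
  by rewrite AE; apply/seteqP; split=> x; rewrite /halfspace /= !fdist fab2 ltn_add2r.
have pre (T : sgraph) (g : G -> T) (A B : set T) :
    crossing (g @^-1` A) (g @^-1` B) -> crossing A B.
  by move=> [[x [? ?]] [y [? ?]] [z [? ?]] [t [? ?]]];
    split; [exists (g x)|exists (g y)|exists (g z)|exists (g t)].
apply/Inc_bipartiteP; exists k; split=> [A|A B hA hB cAB].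
  congr asbool; apply/propext; split=> -[a [b [ab AE fab]]]; exists b, a;
    split; rewrite // 1?adj_sym //.
    by rewrite -[A]setCK AE halfspaceC.
  by rewrite AE halfspaceC.
apply/eqP => kAB; have [[x [Ax Bx]] [y [Ay nBy]] [z [nAz Bz]] _] := cAB.
case: (boolP (k A)) => kA.
  have kB : k B by rewrite -kAB.
  have [A' hA' AE] := kT A kA; have [B' hB' BE] := kT B kB.
  by apply: (tree_no_crossing T2t hA' hB'); apply: (@pre _ (snd \o f)); rewrite -AE -BE.
have kB : ~~ k B by rewrite -kAB.
have [||A' hA' AE] := kF A kA hA; [by exists x|by exists z|].
have [||B' hB' BE] := kF B kB hB; [by exists x|by exists y|].
by apply: (tree_no_crossing T1t hA' hB'); apply: (@pre _ (fst \o f)); rewrite -AE -BE.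
Qed.

End DoubleTreeIncompatibility.

(** * The tree of a family of compatible splits *)

Section TreeOfSplits.
Variables (G : sgraph) (Gmed : median_graph G) (b : G) (C : set (set G)).
Hypothesis C_compatible : forall A B, C A -> C B ->
  convex_half A -> convex_half B -> ~ crossing A B.

Let Gc : connected_graph G := Gmed.1.

(** Passing to traces contracts every edge of G whose split is not represented in C. The vertices of
    the tree are the traces that occur, not all sets of halves. *)
Definition split_trace (x : G) : set (set G) := halves_at b x `&` C.

Definition split_tree : sgraph := family_graph (range split_trace).

Definition to_split_tree (x : G) : split_tree :=
  exist _ (split_trace x) (imageT split_trace x).

Lemma split_tree_connected : connected_graph split_tree.
Proof.
have step x y : adj x y -> exists n, walk (to_split_tree x) (to_split_tree y) n.
  move=> xy; have [H [hH nHb Hxy _ HU]] := separating_half Gmed b xy.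
  case: (pselect (C H)) => CH; last first.
    exists 0; suff -> : to_split_tree x = to_split_tree y by apply: walk0.
    apply: sval_injective => /=; apply/seteqP; rewrite /split_trace /halves_at.
    by split=> K /= [[hK [nKb Kx]] CK]; (split=> //); (split=> //); (split=> //);
      apply/(HU K) => // KH; apply: CH; rewrite -KH.
  exists 1; apply/walk1/asboolP/differ_by_oneP; exists H => /=.
  rewrite /split_trace /halves_at /setI /=; split; first by tauto.
  by move=> K KH; have := HU K; tauto.
suff H n (x y : G) : walk x y n -> exists m, walk (to_split_tree x) (to_split_tree y) m.
  move=> u v; have [[x _ xu] [y _ yv]] := (svalP u, svalP v).
  have -> : u = to_split_tree x by apply: sval_injective.
  have -> : v = to_split_tree y by apply: sval_injective.
  exact: H (dist_walk Gc x y).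
elim: n x => [|n IHn] x; first by move=> /walk0_eq ->; exists 0; apply: walk0.
move=> /walkS_inv[z /step[k xz] /IHn[m zy]].
by exists (k + m); apply: walk_cat zy.
Qed.

(* A cycle must cross back over the split of its first edge; by compatibility
   it does so along the very same edge. *)
Lemma split_tree_acyclic : acyclic split_tree.
Proof.
move=> n n3 [f [fi fhom]]; have [p [pn pa pinj]] := cycle_sequence n3 fhom.
have /choice[x xP] : forall k, exists x, split_trace x = sval (p k).
  by move=> k; have [x _ xk] := svalP (p k); exists x.
have pd k : differ_by_one (split_trace (x k)) (split_trace (x k.+1)).
  by rewrite !xP; apply/asboolP/pa.
have mem k H : convex_half H -> ~ H b -> C H -> split_trace (x k) H <-> H (x k).
  by move=> hH nHb CH; rewrite /split_trace /halves_at /setI /=; tauto.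
have memP k H : split_trace (x k) H -> [/\ convex_half H, ~ H b & C H].
  by rewrite /split_trace /halves_at /setI /= => -[[? [? ?]] ?].
have sep k : exists H, [/\ [/\ convex_half H, ~ H b & C H],
    H (x k) <-> ~ H (x k.+1) & forall K, [/\ convex_half K, ~ K b & C K] ->
      K <> H -> (K (x k) <-> K (x k.+1))].
  have /differ_by_oneP[H [HP KP]] := pd k.
  have HH : [/\ convex_half H, ~ H b & C H].
    case: (pselect (split_trace (x k) H)) => [|nH]; first exact: memP.
    by apply: (memP k.+1); apply: contrapT; tauto.
  exists H; split=> //; case: HH => hH nHb CH.
    by rewrite -!mem.
  by move=> K [hK nKb CK] /KP; rewrite !mem.
have [H [[hH nHb CH] H01 HU]] := sep 0.
have pn' : H (x n) <-> H (x 0).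
  by rewrite -!mem // !xP pn.
(* The first edge flips membership in H and the cycle closes up, so some later edge flips it back.
   The least such endpoint beyond 1 is written [j.+1]. *)
have ex : exists j, `[< 1 < j /\ (H (x j) <-> H (x 0)) >].
  by exists n; apply/asboolP; split=> //; lia.
case: (ex_minnP ex) => -[|j] /asboolP[j1 Hj] jmin //.
have jn : j < n by apply: jmin; apply/asboolP; split=> //; lia.
have Hj1 : H (x j) <-> H (x 1).
  case: (j =P 1) => [-> //|jN1].
  have nHj : ~ (H (x j) <-> H (x 0)).
    by move=> E; have : j.+1 <= j; [apply/jmin/asboolP; split=> //; lia|rewrite ltnn].
  by case: (pselect (H (x 0))); case: (pselect (H (x j))); case: (pselect (H (x 1))); tauto.
have [K [[hK nKb CK] KK HKU]] := sep j.
have KH : K = H.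
  apply: contrapT => KH; have := HKU H (And3 hH nHb CH) (nesym KH).
  by case: (pselect (H (x 0))); case: (pselect (H (x 1))); tauto.
subst K.
(* Another half L is constant on each of the two edges across H. If it differed between these edges,
   their four endpoints would occupy all four intersections of the two splits. *)
have same L : convex_half L -> ~ L b -> C L -> (L (x j) <-> L (x 1)).
  move=> hL nLb CL; case: (pselect (L = H)) => [->//|LH].
  apply: contrapT => Lj1; apply: (C_compatible CH CL hH hL).
  have L0 := HU L (And3 hL nLb CL) LH; have Lj := HKU L (And3 hL nLb CL) LH.
  have pick (P : set G) : P (x 0) \/ P (x 1) \/ P (x j) \/ P (x j.+1) -> P !=set0.
    by move=> [|[|[|]]] ?; eexists; eassumption.
  case: (pselect (H (x 1))) => H1; case: (pselect (L (x 1))) => L1;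
    case: (pselect (L (x j))) => Lj'; split; apply: pick; rewrite /setI /setC /=; tauto.
have eqp i i' : (forall L, convex_half L -> ~ L b -> C L -> (L (x i) <-> L (x i'))) ->
    p i = p i'.
  move=> E; apply: sval_injective; rewrite -!xP; apply/seteqP; split=> L Li;
    have [hL nLb CL] := memP _ _ Li; apply/mem => //; apply/E => //; exact/mem.
(* The returning edge starts at the vertex [p 1], so j = 1 by injectivity. Then [p 2] agrees with
   [p 0] on every half, against n >= 3. *)
have j1' : j = 1.
  case: (ltngtP j 1) => // [|lt1j]; first by lia.
  by case: (pinj fi 1 j) => //; [lia|apply/esym/eqp].
subst j; case: (pinj fi 0 2) => //; apply/esym/eqp => L hL nLb CL.
case: (pselect (L = H)) => [->//|LH].
by rewrite (HU L) // (HKU L).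
Qed.

End TreeOfSplits.

Lemma Inc_bipartite_double_tree (G : sgraph) : median_graph G ->
  bipartite (Inc G) -> partial_double_tree G.
Proof.
move=> Gmed /Inc_bipartiteP[k [_ kP]].
have Gc : connected_graph G := Gmed.1.
have comp i A B : [set H | k H = i] A -> [set H | k H = i] B ->
    convex_half A -> convex_half B -> ~ crossing A B.
  by move=> /= kA kB hA hB /(kP A B hA hB); rewrite kA kB eqxx.
case: (pselect (exists b : G, True)) => [[b _]|nG]; last first.
  (* For the empty graph any two trees serve; [cycle_graph 1] is a single vertex without edges. *)
  pose K1 : sgraph := cycle_graph 1.
  have K1t : tree K1.
    split=> [x y|n n3 [f [fi _]]]; first by exists 0; rewrite (ord1 x) (ord1 y); apply: walk0.
    have := leq_card f fi; rewrite !card_ord; lia.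
  have noG (x : G) : False by apply: nG; exists x.
  exists K1, K1; split=> //; exists (fun x => False_rect _ (noG x)).
  by split; [split|] => x; case: (noG x).
pose T i := split_tree b [set H | k H = i].
have Tt i : tree (T i).
  by split; [exact: split_tree_connected|exact: split_tree_acyclic (comp i)].
exists (T true), (T false); split; try exact: Tt.
pose F (x : G) : cartesian (T true) (T false) :=
  (to_split_tree b [set H | k H = true] x, to_split_tree b [set H | k H = false] x).
have Ufin (u : cartesian (T true) (T false)) : finite_set (sval u.1 `|` sval u.2).
  have [[x _ xu] [y _ yu]] := (svalP u.1, svalP u.2).
  rewrite finite_setU -xu -yu.
  by split; apply: sub_finite_set (finite_halves_at Gmed b _) => H [h _]; apply: h.
(* Merging the two traces recovers all halves at a vertex, so [U \o F] is the isometric hypercube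
   embedding and its first factor [F] is isometric. *)
pose U u : hypercube (set G) := exist _ _ (Ufin u).
have colT i (A : T i) H : sval A H -> k H = i.
  by move: (svalP A) => [x _ <-] [].
exists F; apply: (@isometric_embedding_factor _ _ _ F U) => //.
- by apply: cartesian_connected; apply: (Tt _).1.
- move=> x y xy; apply/asboolP.
  have [H [hH nHb Hxy _ HU]] := separating_half Gmed b xy.
  have diff i : k H = i -> adj (to_split_tree b [set H | k H = i] x)
      (to_split_tree b [set H | k H = i] y).
    move=> kH; apply/asboolP/differ_by_oneP; exists H => /=.
    rewrite /split_trace /halves_at /setI /=; split; first by tauto.
    by move=> K KH; have := HU K; tauto.
  have same i : k H <> i -> to_split_tree b [set H | k H = i] x =
      to_split_tree b [set H | k H = i] y.
    move=> kH; apply: sval_injective; apply/seteqP => /=.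
    have E K : split_trace b [set H | k H = i] x K <-> split_trace b [set H | k H = i] y K.
      rewrite /split_trace /halves_at /setI /=.
      case: (pselect (K = H)) => [->|KH]; first by tauto.
      by have := HU K; tauto.
    by split=> K /E.
  case kH : (k H); [right|left]; split=> /=; try exact: diff; apply: same;
    by rewrite kH.
(* The coordinates contain halves of different colours, so the half that changes in one is absent
   from the other and the union changes by exactly that half. *)
- move=> [A B] [A' B'] /asboolP[] /= [].
    move=> AA /asboolP/differ_by_oneP[H [HP KP]]; subst A'.
    apply/asboolP/differ_by_oneP; exists H => /=; rewrite /setU /=.
    have nAH : ~ sval A H.
      move=> /colT; suff : k H = false by move=> ->.
      case: (pselect (sval B H)) => [/colT //|nBH].
      by apply: (@colT false B'); apply: contrapT; tauto.
    by split; [tauto|move=> K /KP; tauto].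
  move=> /asboolP/differ_by_oneP[H [HP KP]] BB; subst B'.
  apply/asboolP/differ_by_oneP; exists H => /=; rewrite /setU /=.
  have nBH : ~ sval B H.
    move=> /colT; suff : k H = true by move=> ->.
    case: (pselect (sval A H)) => [/colT //|nAH].
    by apply: (@colT true A'); apply: contrapT; tauto.
  by split; [tauto|move=> K /KP; tauto].
suff -> : U \o F = halves_embedding Gmed b by apply: halves_embedding_isometric.
apply/funext => x; apply: sval_injective => /=; apply/seteqP.
rewrite /split_trace /setI /setU; split=> H /=; first by tauto.
by case: (k H); tauto.
Qed.

Lemma median_subgraph_median (G H : sgraph) : connected_graph G ->
  median_subgraph G H -> median_graph G.
Proof.
move=> Gc [Hmed [f [[_ fd] fcl]]]; have /median_graphP[_ _ Hu] := Hmed.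
have fm x y z m : median3 (f x) (f y) (f z) (f m) <-> median3 x y z m.
  by rewrite /median3 !fd.
apply/median_graphP; split=> // [x y z|x y z m m'].
  have [m mP] := Hmed.2 (f x) (f y) (f z).
  have [w _ wm] : range f m by apply: fcl mP; exact: imageT.
  by exists w; apply/fm; rewrite wm; have /is_medianP[] := mP.
move=> /fm h /fm h'; have := Hu _ _ _ _ _ h h' => E.
by apply: (dist0_eq Gc); rewrite -fd E distxx.
Qed.

(** * The equivalences *)

Definition isometric_in_hypercube (G : sgraph) : Prop :=
  (exists X : Type, isometric_subgraph G (hypercube X)) /\
  (forall k : nat, 2 <= k ->
     ~ isometric_subgraph (cycle_graph (2 * k + 2)) G /\
     ~ isometric_subgraph (simplex_graph (cycle_graph (2 * k + 1))) G).

Definition no_isometric_obstruction (G : sgraph) : Prop :=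
  [/\ ~ isometric_subgraph (cycle_graph 3) G,
      ~ isometric_subgraph (complete_bipartite 2 3) G &
      forall k : nat, 2 <= k ->
        ~ isometric_subgraph (cycle_graph (k + 3)) G /\
        ~ isometric_subgraph (simplex_graph (cycle_graph (2 * k + 1))) G].

Lemma Link_no_isometric_cog (G H : sgraph) n (f : cog n -> H) :
  odd n -> 2 < n -> median_graph G -> (forall x : G, bipartite (Link x)) ->
  injective f -> {mono f : c c' / adj c c'} -> ~ isometric_subgraph H G.
Proof.
move=> on n2 Gmed bip fi fa [g [[gi ga] _]].
have /median_graphP[Gc Gm _] := Gmed.
have /(Link_bipartiteP (triangle_free Gc Gm))[col colP] := bip (g (f (Hub n))).
apply: (@cog_odd_link n n2 G (g \o f) col on) => //.
  exact: inj_comp.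
by move=> c c' /=; rewrite ga fa.
Qed.

Lemma Link_no_simplex_graph (G : sgraph) k : median_graph G ->
  (forall x : G, bipartite (Link x)) -> 2 <= k ->
  ~ isometric_subgraph (simplex_graph (cycle_graph (2 * k + 1))) G.
Proof.
move=> Gmed bip k2; have [|f [fi fa _]] := @cog_simplex_graph (2 * k + 1); first by lia.
apply: Link_no_isometric_cog Gmed bip fi fa; last by lia.
by rewrite oddD oddM.
Qed.

Lemma no_isometric_cog (G : sgraph) n : odd n -> 2 < n ->
  (forall v : hypercube 'I_3, ~ isometric_subgraph (Q3_minus v) G) ->
  (forall k : nat, 2 <= k ->
     ~ isometric_subgraph (simplex_graph (cycle_graph (2 * k + 1))) G) ->
  ~ isometric_subgraph (cog n) G.
Proof.
move=> on n2 noQ nok cogG; case: (n =P 3) => [n3|n3].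
  subst n; pose v : hypercube 'I_3 := exist _ set0 finite_finset.
  have [f [_ fa fs]] := cog_Q3_minus v.
  apply: (noQ v); apply: isometric_subgraph_trans cogG.
  exact: (isometric_of_isomorphism (@cog_connected 3) fa fs).
have [|f [_ fa fs]] := @cog_simplex_graph n; first by lia.
have nE : n = 2 * n./2 + 1 by rewrite mul2n addn1 -{1}(odd_double_half n) on.
apply: (nok n./2); first by lia.
rewrite -nE; apply: isometric_subgraph_trans cogG.
exact: (isometric_of_isomorphism (@cog_connected n) fa fs).
Qed.

Lemma Inc_bipartite_hypercube (G : sgraph) :
  median_graph G -> bipartite (Inc G) -> isometric_in_hypercube G.
Proof.
move=> Gmed Inc2; split=> [|k k2]; first exact: median_graph_hypercube.
split; first exact: Inc_bipartite_no_even_cycle.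
apply: Link_no_simplex_graph => // x.
exact/Link_complex_Link/Inc_Link_complex.
Qed.

Lemma hypercube_no_obstruction (G : sgraph) :
  isometric_in_hypercube G -> no_isometric_obstruction G.
Proof.
move=> [[X GX] noG]; split.
- exact: (hypercube_no_odd_cycle GX).
- exact: (hypercube_no_K23 GX).
move=> k k2; split; last by have [] := noG k k2.
case: (boolP (odd (k + 3))) => ok.
  by apply: (hypercube_no_odd_cycle GX) => //; lia.
(* An even k + 3 with k >= 2 has k >= 3, which keeps the new index at least 2 and C_4 out. *)
have kE : k + 3 = 2 * (k.+1)./2 + 2 by lia.
by rewrite kE; have [|] := noG (k.+1)./2; first by lia.
Qed.

Lemma double_tree_median (T1 T2 : sgraph) : tree T1 -> tree T2 ->
  median_graph (cartesian T1 T2).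
Proof.
by move=> T1t T2t; apply: cartesian_median; try exact: tree_median;
  [case: T1t|case: T2t].
Qed.

(** The product is median, so the obstructions can be excluded there through its splits; G, whose
    medians are not yet available, inherits the exclusion as an isometric subgraph. *)
Lemma partial_double_tree_no_obstruction (G : sgraph) :
  partial_double_tree G -> no_isometric_obstruction G.
Proof.
move=> [T1 [T2 [T1t T2t GT]]].
have Hmed := double_tree_median T1t T2t.
have [noC3 noK nok] := hypercube_no_obstruction (Inc_bipartite_hypercube Hmed
  (double_tree_Inc_bipartite T1t T2t (isometric_embedding_id _) Hmed)).
have tr (F : sgraph) : ~ isometric_subgraph F (cartesian T1 T2) ->
    ~ isometric_subgraph F G.
  by move=> nF FG; apply: nF; apply: isometric_subgraph_trans FG GT.
by split=> [||k /nok[? ?]]; [apply: tr..|split; apply: tr].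
Qed.

Lemma no_obstruction_median (G : sgraph) : connected_graph G ->
  no_isometric_obstruction G -> median_graph G.
Proof.
by move=> Gc [noC3 noK nok]; apply: median_graph_of_no_cycle => // k /nok[].
Qed.

(* Q_3 - v contains an isometric C_6. *)
Lemma no_hexagon_no_Q3_minus (G : sgraph) v : median_graph G ->
  ~ isometric_subgraph (cycle_graph 6) G -> ~ isometric_subgraph (Q3_minus v) G.
Proof.
move=> /median_graphP[Gc Gm _] noC [g [[gi ga] _]]; apply: noC.
have [f [fi fa _]] := cog_Q3_minus v.
pose o i : 'I_3 := inord i.
have e c c' : adj (g (f c)) (g (f c')) = adj c c' by rewrite ga fa.
have i1 : ordS (o 0) = o 1 by apply: val_inj; rewrite /= !inordK.
have i2 : ordS (o 1) = o 2 by apply: val_inj; rewrite /= !inordK.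
have i3 : ordS (o 2) = o 0 by apply: val_inj; rewrite /= !inordK.
have oE i j : i < 3 -> j < 3 -> (o i == o j) = (i == j).
  by move=> ? ?; rewrite -val_eqE /= !inordK.
have ne i j : i < 3 -> j < 3 -> i != j -> g (f (Spoke (o i))) <> g (f (Spoke (o j))).
  by move=> ? ? ij /gi /fi [] /eqP; rewrite oE // (negbTE ij).
(* The hexagon alternates between the three spokes and the three rim vertices and avoids the hub. *)
apply: (@isometric_hexagon _ Gc Gm (g (f (Spoke (o 0)))) (g (f (Spoke (o 1))))
  (g (f (Spoke (o 2)))) (g (f (Rim (o 0)))) (g (f (Rim (o 2)))) (g (f (Rim (o 1)))));
  try (by apply: ne); by rewrite e /= ?i1 ?i2 ?i3 !oE.
Qed.

Theorem theorem1 (G : sgraph) (G_connected : connected_graph G) :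
  [<-> partial_double_tree G;
       exists T1 T2 : sgraph,
         [/\ tree T1, tree T2 & median_subgraph G (cartesian T1 T2)];
       median_graph G /\ bipartite (Inc G);
       median_graph G /\ bipartite (Link_complex G);
       median_graph G /\ (forall x : G, bipartite (Link x));
       [/\ median_graph G,
           forall v : hypercube 'I_3, ~ isometric_subgraph (Q3_minus v) G &
           forall k : nat, 2 <= k ->
             ~ isometric_subgraph (simplex_graph (cycle_graph (2 * k + 1))) G];
       (exists X : Type, isometric_subgraph G (hypercube X)) /\
       (forall k : nat, 2 <= k ->
          ~ isometric_subgraph (cycle_graph (2 * k + 2)) G /\
          ~ isometric_subgraph (simplex_graph (cycle_graph (2 * k + 1))) G);
       [/\ ~ isometric_subgraph (cycle_graph 3) G,
           ~ isometric_subgraph (complete_bipartite 2 3) G &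
           forall k : nat, 2 <= k ->
             ~ isometric_subgraph (cycle_graph (k + 3)) G /\
             ~ isometric_subgraph
                 (simplex_graph (cycle_graph (2 * k + 1))) G]].
Proof.
have obstructions : [/\ median_graph G,
    forall v : hypercube 'I_3, ~ isometric_subgraph (Q3_minus v) G &
    forall k : nat, 2 <= k ->
      ~ isometric_subgraph (simplex_graph (cycle_graph (2 * k + 1))) G] ->
    median_graph G /\ bipartite (Inc G).
  move=> [Gmed noQ nok]; split=> //; apply: Link_complex_Inc => //.
  apply: Link_Link_complex => // x; apply: Link_bipartite_of_no_cog => // n on n2.
  exact: no_isometric_cog.
tfae.
- move=> GT; have Gmed := no_obstruction_median G_connected
    (partial_double_tree_no_obstruction GT).
  have [T1 [T2 [T1t T2t [f [fe fd]]]]] := GT; exists T1, T2; split=> //.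
  have Hmed := double_tree_median T1t T2t; split=> //.
  (* The image of a median found in G is a median in the product, where medians are unique. *)
  exists f; split=> // _ _ _ m [x _ <-] [y _ <-] [z _ <-] /is_medianP[_ mU].
  have /median_graphP[_ Gm _] := Gmed; have [w wP] := Gm x y z.
  by exists w => //; apply: mU; rewrite /median3 !fd.
- move=> [T1 [T2 [T1t T2t GT]]].
  have Gmed := median_subgraph_median G_connected GT; split=> //.
  by have [_ [f [fe _]]] := GT; exact: (double_tree_Inc_bipartite T1t T2t fe Gmed).
- by move=> [Gmed Inc2]; split=> //; apply: Inc_Link_complex.
- by move=> [Gmed L2]; split=> // x; apply: Link_complex_Link.
- move=> [Gmed L2]; split=> // [v|k k2]; last exact: Link_no_simplex_graph.
  have [f [fi fa _]] := cog_Q3_minus v.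
  exact: Link_no_isometric_cog Gmed L2 fi fa.
- by move=> /obstructions[Gmed Inc2]; apply: Inc_bipartite_hypercube.
- exact: hypercube_no_obstruction.
- move=> noG; have Gmed := no_obstruction_median G_connected noG.
  have [_ _ nok] := noG.
  have [|_ Inc2] := obstructions; last exact: Inc_bipartite_double_tree.
  split=> // [v|k /nok[]//]; apply: no_hexagon_no_Q3_minus => //.
  by have [] := nok 3 isT.
Qed.
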